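(* There is a $2\pi$-periodic continuous function $u:\mathbb{R}\to\mathbb{R}$ such that: (i) $u$ is nowhere differentiable on $\mathbb{R}$; (ii) its harmonic conjugate $\tilde u$ (defined on $D$) extends continuously to $\overline{D}$; and (iii) the $2\pi$-periodic continuous function $\tilde u|_{\mathbb{T}}$ is nowhere differentiable on $\mathbb{R}$. In fact, the class of functions $f\in\mathcal{A}(D)$ such that $u=\mathrm{Re} f|_{\mathbb{T}}$ has properties (i), (ii) and (iii) is residual in $\mathcal{A}(D)$, i.e. it contains a dense $G_\delta$ subset of $\mathcal{A}(D)$.
   Context: $D$ is the open unit disc in $\mathbb{C}$, $\overline{D}$ its closure, $\mathbb{T}$ the unit circle. The disc algebra $\mathcal{A}(D)$ is the set of continuous functions $f:\overline{D}\to\mathbb{C}$ that are holomorphic on $D$, endowed with the supremum norm. A function $F$ on $\mathbb{T}$ is identified with the $2\pi$-periodic function $\theta\mapsto F(e^{i\theta})$ on $\mathbb{R}$; differentiability is understood with respect to $\theta$, and ''nowhere differentiable'' means not differentiable at any $\theta\in\mathbb{R}$. A continuous $2\pi$-periodic function $u:\mathbb{R}\to\mathbb{R}$, viewed as a function on $\mathbb{T}$, has a unique continuous extension to $\overline{D}$ that is harmonic on $D$ (again denoted $u$); $\tilde u$ denotes a harmonic conjugate of this extension on $D$ (unique up to an additive real constant, which is immaterial here), and when $\tilde u$ extends continuously to $\overline{D}$, $\tilde u|_{\mathbb{T}}$ denotes the restriction to $\mathbb{T}$ of that extension. *)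

(* Defs.v *)
From HB Require Import structures.
From mathcomp Require Import all_boot all_order all_algebra.
From mathcomp Require Import complex.
From mathcomp Require Import all_classical all_reals all_analysis.
From mathcomp Require Import borel_hierarchy.

Set Implicit Arguments.
Unset Strict Implicit.
Unset Printing Implicit Defensive.

Import Order.TTheory GRing.Theory Num.Theory.
Import numFieldNormedType.Exports.

Local Open Scope classical_set_scope.
Local Open Scope ring_scope.
Local Open Scope complex_scope.

(* [R[i]] receives its usual topology, as a normed space over itself. *)
HB.instance Definition _ (R : realType) := NormedModule.copy R[i] R[i]^o.

Section disc.
Context {R : realType}.

Definition open_disc : set R[i] := [set z | `|z| < 1].

Definition closed_disc : set R[i] := [set z | `|z| <= 1].

Definition expi (t : R) : R[i] := cos t +i* sin t.

(* Complex differentiability: the scalars of [derivable] are here those of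
   [R[i]], so the limit of [h^-1 *: (f (h *: 1 + z) - f z)] is taken over
   complex [h]. *)
Definition holomorphic_on (A : set R[i]) (f : R[i] -> R[i]) :=
  forall z, A z -> derivable f z 1.

Definition horizontal (U : R[i] -> R) (z : R[i]) : R -> R :=
  fun t => U (z + t%:C).

Definition vertical (U : R[i] -> R) (z : R[i]) : R -> R :=
  fun t => U (z + t*i).

Definition partial_x (U : R[i] -> R) : R[i] -> R :=
  fun z => (horizontal U z)^`()%classic 0.

Definition partial_y (U : R[i] -> R) : R[i] -> R :=
  fun z => (vertical U z)^`()%classic 0.

Definition C1_on (A : set R[i]) (U : R[i] -> R) :=
  forall z, A z ->
    [/\ derivable (horizontal U z) 0 1, derivable (vertical U z) 0 1,
        {for z, continuous (partial_x U)} & {for z, continuous (partial_y U)}].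

Definition C2_on (A : set R[i]) (U : R[i] -> R) :=
  [/\ C1_on A U, C1_on A (partial_x U) & C1_on A (partial_y U)].

Definition harmonic_on (A : set R[i]) (U : R[i] -> R) :=
  C2_on A U /\
  forall z, A z -> partial_x (partial_x U) z + partial_y (partial_y U) z = 0.

Definition harmonic_extension (u : R -> R) (U : R[i] -> R) :=
  [/\ {within closed_disc, continuous U}, harmonic_on open_disc U &
      forall t, U (expi t) = u t].

Definition harmonic_conjugate (U V : R[i] -> R) :=
  harmonic_on open_disc V /\ holomorphic_on open_disc (fun z => U z +i* V z).

Definition continuous_extension (V W : R[i] -> R) :=
  {within closed_disc, continuous W} /\ {in open_disc, W =1 V}.

Definition nowhere_differentiable (u : R -> R) := forall t, ~ derivable u t 1.

(* [U] is unique on the closed disc; [V] is unique on the open disc up to an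
   additive constant, which shifts [W] by the same constant and so does not
   affect its differentiability. *)
Definition nowhere_differentiable_with_conjugate (u : R -> R) :=
  nowhere_differentiable u /\
  exists (U V W : R[i] -> R),
    [/\ harmonic_extension u U, harmonic_conjugate U V,
        continuous_extension V W & nowhere_differentiable (W \o expi)].

End disc.

Section disc_algebra.
Context (R : realType).

(* A function on the closed disc is represented by its extension by 0 to the
   whole plane, so that distinct elements differ on the closed disc. *)
Definition disc_algebra_pred : {pred R[i] -> R[i]} :=
  fun f => `[< [/\ {within closed_disc, continuous f},
                   holomorphic_on open_disc f &
                   forall z, ~ closed_disc z -> f z = 0] >].

Lemma disc_algebra_predP f : reflect
  [/\ {within closed_disc, continuous f}, holomorphic_on open_disc f &
      forall z, ~ closed_disc z -> f z = 0]
  (f \in disc_algebra_pred).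
Proof. exact: asboolP. Qed.

Lemma disc_algebra_submod_closed : submod_closed disc_algebra_pred.
Proof.
split.
  apply/disc_algebra_predP; split.
  - by apply: continuous_subspaceT => z; exact: cst_continuous.
  - by move=> z _; exact: derivable_cst.
  - by [].
move=> a f g /disc_algebra_predP[cf hf f0] /disc_algebra_predP[cg hg g0].
apply/disc_algebra_predP; split.
- move=> z; apply: continuousD; last exact: cg.
  by apply: continuousZl_tmp; exact: cf.
- by move=> z Dz; apply: derivableD; [apply: derivableZ; exact: hf | exact: hg].
- by move=> z nz; rewrite !fctE/= f0// g0// scaler0 addr0.
Qed.

HB.instance Definition _ :=
  GRing.isSubmodClosed.Build R[i] (R[i] -> R[i]) disc_algebra_pred
    disc_algebra_submod_closed.

Record disc_algebra := DiscAlgebra {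
  disc_fun :> R[i] -> R[i];
  disc_funP : disc_fun \in disc_algebra_pred }.

HB.instance Definition _ := [isSub for disc_fun].
HB.instance Definition _ := [Choice of disc_algebra by <:].
HB.instance Definition _ := [SubChoice_isSubLmodule of disc_algebra by <:].

Lemma real_complex_continuous : continuous (fun x : R => x%:C).
Proof.
move=> x; apply/cvgrPdist_lt => e e0.
have er : e = (complex.Re e)%:C by rewrite RRe_real// gtr0_real.
have e0' : 0 < complex.Re e by rewrite -ltcR -er.
have : \forall y \near x, `|x - y| < complex.Re e by exact: nbhsx_ballx.
apply: filterS => y xy.
by rewrite er -rmorphB/= normc_def/= expr0n/= addr0 sqrtr_sqr ltcR.
Qed.

Lemma closed_disc_compact : compact (@closed_disc R).
Proof.
pose g (p : R * R) : R[i] := p.1 +i* p.2.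
pose B := [set p : R * R | p.1 ^+ 2 + p.2 ^+ 2 <= 1].
have -> : closed_disc = g @` B.
  apply/seteqP; split => [[a b]|_ [[a b] + <-]];
    rewrite /closed_disc/B/g/= normc_def/=.
    rewrite -[1]/(1%:C) lecR => h; exists (a, b) => //=.
    by rewrite -(ler_sqrt _ (@ler01 R)) sqrtr1.
  by rewrite -[1 : R[i]]/(1%:C) lecR -(ler_sqrt _ (@ler01 R)) sqrtr1.
apply: continuous_compact.
  apply: continuous_subspaceT => -[a b].
  have -> : g = (fun p => p.1%:C + 'i * p.2%:C)
    by apply/funext=> p; exact: complexE.
  apply: cvgD; last apply: cvgM.
  - apply: continuous_comp; first exact: cvg_fst.
    exact: real_complex_continuous.
  - exact: cvg_cst.
  - apply: continuous_comp; first exact: cvg_snd.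
    exact: real_complex_continuous.
pose I : set R := `[-1, 1]%classic.
apply: (@subclosed_compact _ B (I `*` I)).
- have -> : B = (fun p : R * R => p.1 * p.1 + p.2 * p.2) @^-1` [set x | x <= 1].
    by apply/seteqP; split => p; rewrite /B/= !expr2.
  apply: closed_comp; last exact: closed_le.
  move=> p _; apply: cvgD; apply: cvgM;
    by [exact: cvg_fst | exact: cvg_snd].
- by apply: compact_setX; exact: segment_compact.
- have sq (x y : R) : x ^+ 2 + y ^+ 2 <= 1 -> x \in `[-1, 1].
    move=> h; rewrite in_itv/= -ler_norml -(@expr_le1 _ 2)//.
    rewrite real_normK ?num_real//.
    by apply: le_trans h; rewrite lerDl sqr_ge0.
  by move=> [a b] h; split; [exact: sq h | apply: (sq b a); rewrite addrC].
Qed.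

Lemma Re_norm_continuous : continuous (fun z : R[i] => complex.Re `|z|).
Proof.
move=> z; apply/(@cvgrPdist_lt _ _ _ _ (nbhs_filter z)) => e e0.
have e0' : 0 < e%:C by rewrite -[0]/(0%:C) ltcR.
have : \forall w \near z, `|z - w| < e%:C by exact: nbhsx_ballx.
apply: (@filterS _ (nbhs z) (nbhs_filter z)) => w.
rewrite -ltcR; apply: le_lt_trans.
have -> : `|complex.Re `|z| - complex.Re `|w| |%:C = `| `|z| - `|w| |.
  rewrite -[X in _ = `|X - _|]RRe_real ?normr_real//.
  rewrite -[X in _ = `|_ - X|]RRe_real ?normr_real//.
  by rewrite -rmorphB/= normc_def/= expr0n/= addr0 sqrtr_sqr.
exact: ler_dist_dist.
Qed.

Definition disc_algebra_norm_real (f : disc_algebra) : R :=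
  sup [set complex.Re `|f z| | z in closed_disc].

Lemma disc_algebra_has_sup (f : disc_algebra) :
  has_sup [set complex.Re `|f z| | z in closed_disc].
Proof.
split.
  by exists (complex.Re `|f 0|), 0 => //=; rewrite /closed_disc/= normr0.
have /disc_algebra_predP[cf _ _] := disc_funP f.
have cnf : {within closed_disc, continuous (fun z => complex.Re `|f z|)}.
  by move=> z; apply: continuous_comp; [exact: cf | exact: Re_norm_continuous].
have := compact_bounded (continuous_compact cnf closed_disc_compact).
move=> [M [_ hM]]; exists (M + 1) => x Dx.
by apply: le_trans (ler_norm _) _; apply: hM => //; rewrite ltrDl.
Qed.

Lemma disc_algebra_norm_real_ub (f : disc_algebra) z : closed_disc z ->
  `|f z| <= (disc_algebra_norm_real f)%:C.
Proof.
move=> Dz; rewrite -[leLHS]RRe_real ?normr_real// lecR.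
by apply: sup_upper_bound; [exact: disc_algebra_has_sup | exists z].
Qed.

Lemma disc_algebra_norm_real_le (f : disc_algebra) (M : R) :
  (forall z, closed_disc z -> `|f z| <= M%:C) -> disc_algebra_norm_real f <= M.
Proof.
move=> h; apply: ge_sup; first by case: (disc_algebra_has_sup f).
by move=> _ [z /h fz <-]; rewrite -lecR RRe_real ?normr_real.
Qed.

(* As for [R[i]] itself, the norm has to take its values in the scalars. *)
Definition disc_algebra_norm (f : disc_algebra) : R[i] :=
  (disc_algebra_norm_real f)%:C.

Lemma disc_algebra_ler_normD f g :
  disc_algebra_norm (f + g) <= disc_algebra_norm f + disc_algebra_norm g.
Proof.
rewrite -rmorphD lecR; apply: disc_algebra_norm_real_le => z Dz.
rewrite rmorphD; apply: le_trans (ler_normD _ _) _.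
by rewrite lerD// disc_algebra_norm_real_ub.
Qed.

Lemma disc_algebra_normrZ (a : R[i]) f :
  disc_algebra_norm (a *: f) = `|a| * disc_algebra_norm f.
Proof.
have le (b : R[i]) (g : disc_algebra) :
    disc_algebra_norm (b *: g) <= `|b| * disc_algebra_norm g.
  pose c := complex.Re `|b|.
  have cE : `|b| = c%:C by rewrite RRe_real ?normr_real.
  have cM (x : R) : `|b| * x%:C = (c * x)%:C by rewrite cE -rmorphM.
  rewrite cM lecR; apply: disc_algebra_norm_real_le => z Dz.
  rewrite -cM [X in `|X|](_ : _ = b * g z)// normrM ler_wpM2l//.
  exact: disc_algebra_norm_real_ub.
apply/le_anti; rewrite le/=.
have [->|a0] := eqVneq a 0.
  rewrite normr0 mul0r ler0c.
  apply: le_trans (ub_le_sup (disc_algebra_has_sup _).2 _); last first.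
    by exists 0 => //; rewrite /closed_disc/= normr0.
  by rewrite -ler0c RRe_real ?normr_real.
by rewrite -ler_pdivlMl ?normr_gt0// -normfV -{1}[f](scalerK a0) le.
Qed.

Lemma disc_algebra_normr0_eq0 f : disc_algebra_norm f = 0 -> f = 0.
Proof.
move=> /complexI f0; apply/val_inj/funext => z /=.
have [Dz|nDz] := pselect (closed_disc z).
  have := disc_algebra_norm_real_ub f Dz.
  by rewrite f0 normr_le0 => /eqP.
by have /disc_algebra_predP[_ _ ->] := disc_funP f.
Qed.

HB.instance Definition _ := @Lmodule_isNormed.Build R[i] disc_algebra
  disc_algebra_norm disc_algebra_ler_normD disc_algebra_normrZ
  disc_algebra_normr0_eq0.

End disc_algebra.

Definition residual (T : topologicalType) (A : set T) :=
  exists2 G : set T, Gdelta G /\ dense G & G `<=` A.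

(* Main.v *)
Require Import Defs.
From HB Require Import structures.
From mathcomp Require Import all_boot all_order all_algebra.
From mathcomp Require Import complex.
From mathcomp Require Import all_classical all_reals all_analysis.
From mathcomp Require Import ring lra.
From mathcomp Require borel_hierarchy.

Set Implicit Arguments.
Unset Strict Implicit.
Unset Printing Implicit Defensive.

Import Order.TTheory GRing.Theory Num.Theory.
Import numFieldNormedType.Exports.
Local Open Scope classical_set_scope.
Local Open Scope ring_scope.


(** A function on the circle is nowhere differentiable as soon as it
    oscillates around every point, at arbitrarily small scales, much more than
    a differentiable function can.  Call [f] [rough] at level [n], in the
    direction of a unimodular number [c], when every [t] has an increment [h]
    with [0 < |h| < 1/(n+1)] over which [Re (c f(e^(it)))] changes by more than
    [n |h|].  Being rough at all levels for [c = 1] and for [c = -i] forces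
    [Re f] and [Im f] to be nowhere differentiable on the circle
    ([rough_nowhere_differentiable]).  Now let [f] be any element of the disc
    algebra.  It is uniformly continuous, so adding [e z^N] with a tiny [e] and
    a huge [N] creates at scale [1/N] an oscillation of size comparable to [e],
    in every direction, while [f] itself hardly moves at that scale; and the
    oscillation survives small perturbations ([rough_perturbation]).  Hence the
    interior of the set of functions rough at level [n] is dense, and the
    intersection of these interiors is the desired dense G-delta set, by
    Baire's argument with nested balls ([disc_baire]).

    What remains is complex analysis: the limit of the nested balls has to be
    holomorphic, and [Re f] and [Im f] have to be twice continuously
    differentiable and harmonic, although the elements of the disc algebra are
    only assumed to be complex differentiable at each point.  Both facts come
    from one inequality, [|f'(b)| <= C sup |f| / r] ([cauchy_estimate]).  To
    prove it, let [G z = (f z - f b) / (z - b)^2].  Goursat's theorem for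
    rectangles shows that the integral of [G] is the same along all squares
    centred at [b]; along a large square it is at most a multiple of
    [sup |f| / r], and along a small one it is close to [f'(b)] times the
    integral of [1 / (z - b)], whose modulus is at least 2.

    If holomorphic functions [g_n] converge uniformly, the estimate applied to
    [g_n - g_m] shows that these differences have small Lipschitz constants on
    smaller discs, so that the difference quotients of the limit converge
    ([weierstrass]).  If [f] is holomorphic, the estimate applied to
    [f (z + h) - f z] shows that [f'] is Lipschitz on small discs, so that the
    difference quotients of [f] converge to [f'] uniformly there, and [f'] is
    holomorphic as well ([holomorphic_derive]).  The partial derivatives of
    [Re f] are then the real parts of [f'] and [i f'], which gives smoothness
    and harmonicity ([harmonic_Re]); the harmonic conjugate of [Re f] is
    [Im f], the real part of [- i f]. *)


(** * Modulus and complex derivatives *)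

Local Notation cabs := Normc.normc.

(* Proves an equality of complex numbers from its real and imaginary parts. *)
Ltac ceq := apply/eqP; rewrite eq_complex /=; apply/andP; split;
  apply/eqP; ring.

Section modulus.
Local Open Scope complex_scope.
Local Notation Re := (@complex.Re _).
Local Notation Im := (@complex.Im _).
Variable R : realType.
Implicit Types (z w h : R[i]) (f : R[i] -> R[i]).


Lemma cabs_ge0 z : 0 <= cabs z.
Proof. by case: z => a b; exact: sqrtr_ge0. Qed.

Lemma cabsB z w : cabs (z - w) = cabs (w - z).
Proof. by rewrite -normcN opprB. Qed.

Lemma cabsD z w : cabs (z + w) <= cabs z + cabs w.
Proof. exact: le_normcD. Qed.

Lemma cabs_real (x : R) : cabs (x%:C) = `|x|.
Proof. by rewrite /= expr0n/= addr0 sqrtr_sqr. Qed.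

Lemma cabs_i : cabs ('i%C : R[i]) = 1.
Proof. by rewrite /= expr0n/= add0r expr1n sqrtr1. Qed.

Lemma cabs_gt0 z : z != 0 -> 0 < cabs z.
Proof.
move=> z0; rewrite lt_neqAle cabs_ge0 andbT eq_sym.
by apply: contra_neq z0 => /Normc.eq0_normc.
Qed.

Lemma cabs_Re z : `|Re z| <= cabs z.
Proof. by rewrite -lecR; exact: normc_ge_Re. Qed.

Lemma cabs_Im z : `|Im z| <= cabs z.
Proof.
case: z => a b /=; rewrite -sqrtr_sqr ler_sqrt ?addr_ge0 ?sqr_ge0//.
by rewrite lerDr sqr_ge0.
Qed.

Lemma cabs_le_ReIm z : cabs z <= `|Re z| + `|Im z|.
Proof.
case: z => a b; have -> : a +i* b = a%:C + 'i%C * b%:C by exact: (complexE (a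
  +i* b)).
by rewrite (le_trans (cabsD _ _))// Normc.normcM cabs_i mul1r !cabs_real/=;
  rewrite ?(mul0r,mulr0,mul1r,subr0,add0r,addr0).
Qed.

(** The radii of the norm of [R[i]] are complex numbers; this rephrases its
    neighborhoods with real radii, for which real arithmetic is available. *)
Lemma nbhs_cabsP z (P : set R[i]) : nbhs z P <->
  exists2 d : R, 0 < d & forall w, cabs (w - z) < d -> P w.
Proof.
split=> [/nbhs_ballP[d d0 dP]|[d d0 dP]].
  have dE : d = (Re d)%:C by rewrite RRe_real// gtr0_real.
  exists (Re d) => [|w wd]; first by rewrite -ltcR -dE.
  apply: dP; rewrite -ball_normE /= dE -[`|_|]/((cabs (z - w))%:C) ltcR.
  by rewrite cabsB.
apply/nbhs_ballP; exists d%:C; first by rewrite /= ltcR.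
move=> w; rewrite -ball_normE /= -[`|_|]/((cabs (z - w))%:C) ltcR cabsB.
exact: dP.
Qed.

(** Differentiability as a first-order expansion: unlike the limit of a
    quotient, it needs no case distinction on the increment and can be summed
    and integrated directly. *)
Definition has_cderiv f z (A : R[i]) := forall e : R, 0 < e ->
  exists2 d : R, 0 < d & forall h, cabs h < d ->
    cabs (f (z + h) - f z - A * h) <= e * cabs h.

Lemma derivable_has_cderiv f z : derivable f z 1 -> has_cderiv f z ('D_1 f z).
Proof.
move=> fz e e0.
have /(@cvgrPdist_lt R[i] R[i]) H := fz.
have /H : 0 < e%:C by rewrite ltcR.
move=> /nbhs_cabsP[d d0 dP]; exists d => // h hd.
have [->|h0] := eqVneq h 0.
  by rewrite addr0 mulr0 subrr subr0 Normc.normc0 mulr0.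
have := dP h; rewrite subr0 => /(_ hd h0).
rewrite -[`|_|]/((cabs (_))%:C) ltcR => /ltW.
rewrite -[lim _]/('D_1 f z) => le.
have -> : f (z + h) - f z - 'D_1 f z * h =
    - (('D_1 f z - h^-1 *: ((f \o shift z) (h *: 1) - f z)) * h).
  rewrite /= [h *: 1]mulr1 [h + z]addrC /GRing.scale/=; field.
  exact: h0.
by rewrite normcN Normc.normcM ler_wpM2r// cabs_ge0.
Qed.

Lemma has_cderiv_is_derive f z A : has_cderiv f z A -> is_derive z 1 f A.
Proof.
move=> H.
have cv : (fun h => h^-1 *: ((f \o shift z) (h *: 1) - f z)) @ 0^' --> A.
  apply/(@cvgrPdist_lt R[i] R[i]) => e e0.
  have eE : e = (Re e)%:C by rewrite RRe_real// gtr0_real.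
  have e0' : 0 < Re e / 2 by rewrite divr_gt0// -ltcR -eE.
  have [d d0 dP] := H _ e0'; apply/nbhs_cabsP; exists d => // h.
  rewrite subr0 => /dP hd h0.
  rewrite -[`|_|]/((cabs (_))%:C) eE ltcR.
  apply: (@le_lt_trans _ _ (Re e / 2)); last by lra.
  rewrite -(ler_pM2r (cabs_gt0 h0)); apply: le_trans hd.
  rewrite -Normc.normcM -normcN.
  suff -> : - ((A - h^-1 *: ((f \o shift z) (h *: 1) - f z)) * h) =
    f (z + h) - f z - A * h by [].
  rewrite /= [h *: 1]mulr1 [h + z]addrC /GRing.scale/=; field.
  exact: h0.
split; first by apply/cvg_ex; exists A.
exact: (cvg_lim _ cv).
Qed.

Lemma has_cderiv_derivable f z A : has_cderiv f z A -> derivable f z 1.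
Proof. by move/has_cderiv_is_derive => H; exact: (@ex_derive _ _ _ _ _ _ _ H).
  Qed.

Lemma has_cderiv_derive f z A : has_cderiv f z A -> 'D_1 f z = A.
Proof. by move/has_cderiv_is_derive => H; exact: (@derive_val _ _ _ _ _ _ _ H).
  Qed.

Lemma continuous_cabsP f z : {for z, continuous f} <->
  forall e : R, 0 < e -> exists2 d : R, 0 < d &
    forall w, cabs (w - z) < d -> cabs (f w - f z) < e.
Proof.
split=> [/(@cvgrPdist_lt R[i] R[i] _ _ (nbhs_filter z) f (f z)) H e e0|H].
  have /H/nbhs_cabsP[d d0 dP] : 0 < e%:C by rewrite ltcR.
  exists d => // w /dP; rewrite -[`|_|]/((cabs (_))%:C) ltcR cabsB; exact.
apply/(@cvgrPdist_lt R[i] R[i] _ _ (nbhs_filter z) f (f z)) => e e0.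
have eE : e = (Re e)%:C by rewrite RRe_real// gtr0_real.
have [|d d0 dP] := H (Re e); first by rewrite -ltcR -eE.
apply/nbhs_cabsP; exists d => // w /dP.
by rewrite -[`|_|]/((cabs (_))%:C) eE ltcR cabsB.
Qed.

End modulus.

(** * Integrals of complex-valued functions of a real variable *)

Section complex_integral.
Local Open Scope complex_scope.
Local Notation Re := (@complex.Re _).
Local Notation Im := (@complex.Im _).
Variable R : realType.
Implicit Types (a b c : R) (F G : R -> R[i]).
Local Notation mu := (@lebesgue_measure R).

Lemma Re_continuous : continuous (@complex.Re R).
Proof.
move=> z; apply/(@cvgrPdist_lt _ _ _ _ (nbhs_filter z)) => e e0.
apply/nbhs_cabsP; exists e => // w wz.
by apply: le_lt_trans wz; rewrite distrC -raddfB; exact: cabs_Re.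
Qed.

Lemma Im_continuous : continuous (@complex.Im R).
Proof.
move=> z; apply/(@cvgrPdist_lt _ _ _ _ (nbhs_filter z)) => e e0.
apply/nbhs_cabsP; exists e => // w wz.
by apply: le_lt_trans wz; rewrite distrC -raddfB; exact: cabs_Im.
Qed.

Definition cint a b F : R[i] :=
  \int[mu]_(x in `[a, b]) Re (F x) +i* \int[mu]_(x in `[a, b]) Im (F x).

(** Continuity as a function on the whole line, at the points of [[a, b]]: the
    integrands below are restrictions of functions of a complex variable that
    are continuous near the segment. *)
Definition continuous_on a b F :=
  forall x, a <= x <= b -> {for x, continuous F}.

Lemma continuous_on_integrable a b (f : R -> R) :
  (forall x, a <= x <= b -> {for x, continuous f}) ->
  mu.-integrable `[a, b] (EFin \o f).
Proof.
move=> cf; apply: continuous_compact_integrable; first exact: segment_compact.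
apply: continuous_in_subspaceT => x /set_mem; rewrite /= in_itv/=; exact: cf.
Qed.

Lemma integrable_Re a b F : continuous_on a b F ->
  mu.-integrable `[a, b] (EFin \o (fun x => Re (F x))).
Proof.
move=> cF; apply: (@continuous_on_integrable a b (Re \o F)) => x /cF cFx.
by apply: continuous_comp => //; exact: Re_continuous.
Qed.

Lemma integrable_Im a b F : continuous_on a b F ->
  mu.-integrable `[a, b] (EFin \o (fun x => Im (F x))).
Proof.
move=> cF; apply: (@continuous_on_integrable a b (Im \o F)) => x /cF cFx.
by apply: continuous_comp => //; exact: Im_continuous.
Qed.

Lemma eq_cint a b F G : (forall x, a <= x <= b -> F x = G x) ->
  cint a b F = cint a b G.
Proof.
by move=> FG; congr (_ +i* _); apply: eq_Rintegral => x /set_mem;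
  rewrite /= in_itv/= => /FG ->.
Qed.

Lemma cintD a b F G : continuous_on a b F -> continuous_on a b G ->
  cint a b (fun x => F x + G x) = cint a b F + cint a b G.
Proof.
move=> cF cG; rewrite /cint.
under eq_Rintegral do rewrite raddfD.
rewrite RintegralD//; [|exact: integrable_Re|exact: integrable_Re].
under [X in _ +i* X]eq_Rintegral do rewrite raddfD.
by rewrite RintegralD//; [exact: integrable_Im|exact: integrable_Im].
Qed.

Lemma Rintegral_cst_itv a b (r : R) : a <= b ->
  \int[mu]_(_ in `[a, b]) r = r * (b - a).
Proof.
move=> ab; rewrite Rintegral_cst//= lebesgue_measure_itv/= lte_fin.
by case: ltgtP ab => //= -> _; rewrite subrr.
Qed.

Lemma cint_cst a b (c : R[i]) : a <= b -> cint a b (fun=> c) = (b - a)%:C * c.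
Proof.
move=> ab; rewrite /cint !Rintegral_cst_itv//; case: c => c d /=.
by apply/eqP; rewrite eq_complex/= !mul0r subr0 addr0 !(mulrC (b - a)) !eqxx.
Qed.

Lemma Rintegral_split a b c (f : R -> R) : a <= c <= b ->
  mu.-integrable `[a, b] (EFin \o f) ->
  \int[mu]_(x in `[a, b]) f x =
  \int[mu]_(x in `[a, c]) f x + \int[mu]_(x in `[c, b]) f x.
Proof.
move=> /andP[ac cb] fi.
have := Rintegral_itvB fi (x := c); rewrite !bnd_simp => /(_ ac cb) H.
rewrite -(@Rintegral_itv_obnd_cbnd _ c (BRight b)); first by rewrite -H addrC
  subrK.
apply: integrableS fi => //; apply: subset_itvr.
by rewrite bnd_simp.
Qed.

Lemma cint_split a b c F : a <= c <= b -> continuous_on a b F ->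
  cint a b F = cint a c F + cint c b F.
Proof.
move=> acb cF; rewrite /cint (Rintegral_split acb (integrable_Re cF)).
by rewrite (Rintegral_split acb (integrable_Im cF)).
Qed.

Lemma Rintegral_bound a b M (f : R -> R) : a <= b ->
  mu.-integrable `[a, b] (EFin \o f) ->
  (forall x, a <= x <= b -> `|f x| <= M) ->
  `|\int[mu]_(x in `[a, b]) f x| <= M * (b - a).
Proof.
move=> ab fi fM; rewrite -Rintegral_cst_itv//.
have ci (k : R) : mu.-integrable `[a, b] (EFin \o fun=> k).
  by apply: continuous_on_integrable => x _; exact: cst_continuous.
rewrite ler_norml; apply/andP; split.
  have -> : - (\int[mu]_(_ in `[a, b]) M) = \int[mu]_(_ in `[a, b]) (- M).
    by rewrite !Rintegral_cst_itv// mulNr.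
  apply: le_Rintegral => // x; rewrite /= in_itv/= => /fM.
  by rewrite ler_norml => /andP[].
apply: le_Rintegral => // x; rewrite /= in_itv/= => /fM.
by rewrite ler_norml => /andP[].
Qed.

(** The factor 2 comes from bounding real and imaginary parts separately; only
    the order of magnitude of integrals matters in what follows. *)
Lemma cint_bound a b M F : a <= b -> continuous_on a b F ->
  (forall x, a <= x <= b -> cabs (F x) <= M) ->
  cabs (cint a b F) <= 2 * M * (b - a).
Proof.
move=> ab cF FM; apply: le_trans (cabs_le_ReIm _) _ => /=.
rewrite -mulrA mulr_natl mulr2n lerD//; apply: Rintegral_bound => //.
- exact: integrable_Re.
- by move=> x /FM; apply: le_trans; exact: cabs_Re.
- exact: integrable_Im.
- by move=> x /FM; apply: le_trans; exact: cabs_Im.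
Qed.

Lemma cint_Re_ge a b m F : a <= b -> continuous_on a b F ->
  (forall x, a <= x <= b -> m <= Re (F x)) -> m * (b - a) <= Re (cint a b F).
Proof.
move=> ab cF mF; rewrite /= -Rintegral_cst_itv//.
apply: le_Rintegral => //.
- by apply: continuous_on_integrable => x _; exact: cst_continuous.
- exact: integrable_Re.
Qed.

End complex_integral.

(** * Goursat's theorem for rectangles *)


Section goursat.
Local Open Scope complex_scope.
Local Notation Re := (@complex.Re _).
Local Notation Im := (@complex.Im _).
Variable R : realType.
Implicit Types (x y w h a b : R) (G : R[i] -> R[i]).

Lemma nested_intervals_point (u v : nat -> R) :
  (forall n, u n <= u n.+1) -> (forall n, v n.+1 <= v n) ->
  (forall n, u n <= v n) -> exists a, forall n, u n <= a <= v n.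
Proof.
move=> uS vS uv.
have uM : {homo u : n m / (n <= m)%N >-> n <= m}.
  by apply: homo_leq => //; exact: le_trans.
have vM : {homo v : n m / (n <= m)%N >-> m <= n}.
  by apply: homo_leq => // x y z /[swap]; exact: le_trans.
have ub m : ubound (range u) (v m).
  move=> _ [n _ <-]; apply: (@le_trans _ _ (u (maxn n m))).
    by apply: uM; exact: leq_maxl.
  by apply: le_trans (uv _) _; apply: vM; exact: leq_maxr.
have hs : has_sup (range u) by split; [exists (u 0%N), 0%N | exists (v 0%N)].
exists (sup (range u)) => n; apply/andP; split.
  by apply: sup_upper_bound => //; exists n.
by apply: ge_sup => //; exact: hs.1.
Qed.

(** Bisection in the plane: otherwise some sequence of nested quarters, all
    violating [P], would shrink to a point, around which [P] holds for small
    rectangles. *)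
Lemma quartering (P : R -> R -> R -> R -> Prop) x0 y0 w0 h0 :
  0 <= w0 -> 0 <= h0 ->
  (forall x y w h, 0 <= w -> 0 <= h ->
    P x y (w / 2) (h / 2) -> P (x + w / 2) y (w / 2) (h / 2) ->
    P x (y + h / 2) (w / 2) (h / 2) ->
    P (x + w / 2) (y + h / 2) (w / 2) (h / 2) -> P x y w h) ->
  (forall a b, x0 <= a <= x0 + w0 -> y0 <= b <= y0 + h0 ->
    exists2 d, 0 < d & forall x y w h, 0 <= w -> 0 <= h ->
      x <= a <= x + w -> y <= b <= y + h -> w + h < d -> P x y w h) ->
  P x0 y0 w0 h0.
Proof.
move=> w0_ge0 h0_ge0 quarter local; apply: contrapT => nP.
pose W n := w0 / 2 ^+ n; pose H n := h0 / 2 ^+ n.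
have WS n : W n.+1 = W n / 2 by rewrite /W exprS invfM mulrA mulrAC.
have HS n : H n.+1 = H n / 2 by rewrite /H exprS invfM mulrA mulrAC.
have W0 n : 0 <= W n by rewrite /W divr_ge0// exprn_ge0.
have H0 n : 0 <= H n by rewrite /H divr_ge0// exprn_ge0.
have step (q : nat * (R * R)) : exists q' : R * R,
    ~ P q.2.1 q.2.2 (W q.1) (H q.1) ->
    [/\ ~ P q'.1 q'.2 (W q.1.+1) (H q.1.+1),
        q.2.1 <= q'.1 <= q.2.1 + W q.1.+1 & q.2.2 <= q'.2 <= q.2.2 + H q.1.+1].
  case: q => n [x y] /=.
  have [Pxy|nPxy] := pselect (P x y (W n) (H n)).
    by exists (x, y) => nPxy.
  have le0W : x <= x <= x + W n.+1 by rewrite lexx lerDl W0.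
  have leWW : x <= x + W n.+1 <= x + W n.+1 by rewrite lexx andbT lerDl W0.
  have le0H : y <= y <= y + H n.+1 by rewrite lexx lerDl H0.
  have leHH : y <= y + H n.+1 <= y + H n.+1 by rewrite lexx andbT lerDl H0.
  apply: contrapT => nq; apply: nPxy; apply: quarter => //; rewrite -WS -HS;
    apply: contrapT => nPq; apply: nq.
  - by exists (x, y).
  - by exists (x + W n.+1, y).
  - by exists (x, y + H n.+1).
  - by exists (x + W n.+1, y + H n.+1).
have [f fP] := choice step.
pose fix q n := if n is m.+1 then f (m, q m) else (x0, y0).
have nPq n : ~ P (q n).1 (q n).2 (W n) (H n).
  elim: n => [|n IH]; first by rewrite /W /H !expr0 !divr1.
  by have [] := fP (n, q n) IH.
have qx n : (q n).1 <= (q n.+1).1 <= (q n).1 + W n.+1.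
  by have [] := fP (n, q n) (nPq n).
have qy n : (q n).2 <= (q n.+1).2 <= (q n).2 + H n.+1.
  by have [] := fP (n, q n) (nPq n).
have [a aP] : exists a, forall n, (q n).1 <= a <= (q n).1 + W n.
  apply: nested_intervals_point => n; first by have /andP[] := qx n.
    by have /andP[_] := qx n; have := WS n; lra.
  by rewrite lerDl.
have [b bP] : exists b, forall n, (q n).2 <= b <= (q n).2 + H n.
  apply: nested_intervals_point => n; first by have /andP[] := qy n.
    by have /andP[_] := qy n; have := HS n; lra.
  by rewrite lerDl.
have [||d d0 dP] := local a b.
- by have := aP 0%N; rewrite /W expr0 divr1.
- by have := bP 0%N; rewrite /H expr0 divr1.
have [n nd] : exists n, W n + H n < d.
  pose n := (Num.truncn ((w0 + h0) / d)).+1; exists n.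
  have : (w0 + h0) / d < n%:R by rewrite truncnS_gt.
  rewrite /W /H -mulrDl ltr_pdivrMr// ltr_pdivrMr ?exprn_gt0// => lt.
  apply: (lt_le_trans lt); rewrite mulrC ler_pM2l // -natrX ler_nat.
  exact: (ltnW (ltn_expl _ _)).
exact: (nPq n (dP _ _ _ _ (W0 n) (H0 n) (aP n) (bP n) nd)).
Qed.

(** The integral of [G] along the boundary of a rectangle, with opposite sides
    grouped in one integrand.  With this grouping the integrands are constant
    when [G] is affine, so that no antiderivative is ever needed. *)
Definition rect_int G x0 x1 y0 y1 : R[i] :=
  cint x0 x1 (fun x => G (x +i* y0) - G (x +i* y1)) +
  'i%C * cint y0 y1 (fun y => G (x1 +i* y) - G (x0 +i* y)).

Definition rect x0 x1 y0 y1 : set R[i] :=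
  [set z | x0 <= Re z <= x1 /\ y0 <= Im z <= y1].

Lemma horizontal_line_continuous y : continuous (fun x => x +i* y).
Proof.
move=> x; apply/cvgrPdist_lt => e e0.
have eE : e = (Re e)%:C by rewrite RRe_real// gtr0_real.
near=> t; have -> : x +i* y - (t +i* y) = (x - t)%:C.
  by ceq.
rewrite -[`|_|]/((cabs _)%:C) cabs_real eE ltcR.
by near: t; apply: cvgr_dist_lt => //; rewrite -ltcR -eE.
Unshelve. all: by end_near. Qed.

Lemma vertical_line_continuous x : continuous (fun y => x +i* y).
Proof.
move=> y; apply/cvgrPdist_lt => e e0.
have eE : e = (Re e)%:C by rewrite RRe_real// gtr0_real.
near=> t; have -> : x +i* y - (x +i* t) = 'i%C * (y - t)%:C.
  by ceq.
rewrite -[`|_|]/((cabs _)%:C) Normc.normcM cabs_i mul1r cabs_real eE ltcR.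
by near: t; apply: cvgr_dist_lt => //; rewrite -ltcR -eE.
Unshelve. all: by end_near. Qed.

(** The boundary of a rectangle.  The lemmas on [rect_int] assume continuity
    there only, because they are applied to functions with a singularity
    inside. *)
Definition frame x0 x1 y0 y1 : set R[i] := rect x0 x1 y0 y1 `&`
  [set z | [\/ Re z = x0, Re z = x1, Im z = y0 | Im z = y1]].

Lemma frame_rect x0 x1 y0 y1 z : frame x0 x1 y0 y1 z -> rect x0 x1 y0 y1 z.
Proof. by case. Qed.

Lemma continuous_on_horizontal G x0 x1 y :
  (forall x, x0 <= x <= x1 -> {for x +i* y, continuous G}) ->
  continuous_on x0 x1 (fun x => G (x +i* y)).
Proof.
move=> cG x xx; apply: (@continuous_comp _ _ _ (fun x => x +i* y) G).
  exact: horizontal_line_continuous.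
exact: cG.
Qed.

Lemma continuous_on_vertical G x y0 y1 :
  (forall y, y0 <= y <= y1 -> {for x +i* y, continuous G}) ->
  continuous_on y0 y1 (fun y => G (x +i* y)).
Proof.
move=> cG y yy; apply: (@continuous_comp _ _ _ (fun y => x +i* y) G).
  exact: vertical_line_continuous.
exact: cG.
Qed.

Section continuous_integrand.
Variables (G : R[i] -> R[i]) (x0 x1 y0 y1 : R).
Hypotheses (x01 : x0 <= x1) (y01 : y0 <= y1).
Hypothesis cG : forall z, frame x0 x1 y0 y1 z -> {for z, continuous G}.

Lemma continuous_on_bottom : continuous_on x0 x1 (fun x => G (x +i* y0)).
Proof.
apply: continuous_on_horizontal => x xx.
by apply: cG; split; [split; rewrite //= lexx|constructor 3].
Qed.

Lemma continuous_on_top : continuous_on x0 x1 (fun x => G (x +i* y1)).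
Proof.
apply: continuous_on_horizontal => x xx.
by apply: cG; split; [split; rewrite //= lexx andbT|constructor 4].
Qed.

Lemma continuous_on_left : continuous_on y0 y1 (fun y => G (x0 +i* y)).
Proof.
apply: continuous_on_vertical => y yy.
by apply: cG; split; [split; rewrite //= lexx|constructor 1].
Qed.

Lemma continuous_on_right : continuous_on y0 y1 (fun y => G (x1 +i* y)).
Proof.
apply: continuous_on_vertical => y yy.
by apply: cG; split; [split; rewrite //= lexx andbT|constructor 2].
Qed.

End continuous_integrand.

Lemma continuous_on_cat a b c (F : R -> R[i]) : continuous_on a c F ->
  continuous_on c b F -> continuous_on a b F.
Proof.
move=> cac ccb x /andP[ax xb]; case: (leP x c) => xc.
  by apply: cac; rewrite ax xc.
by apply: ccb; rewrite xb ltW.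
Qed.

Lemma continuous_onB a b (F G : R -> R[i]) : continuous_on a b F ->
  continuous_on a b G -> continuous_on a b (fun x => F x - G x).
Proof. by move=> cF cG x xab; apply: continuousB; [exact: cF|exact: cG]. Qed.

Section rect_int_theory.
Variables (x0 x1 y0 y1 : R).
Hypotheses (x01 : x0 <= x1) (y01 : y0 <= y1).

Lemma rect_intD F G :
  (forall z, frame x0 x1 y0 y1 z -> {for z, continuous F}) ->
  (forall z, frame x0 x1 y0 y1 z -> {for z, continuous G}) ->
  rect_int (fun z => F z + G z) x0 x1 y0 y1 =
  rect_int F x0 x1 y0 y1 + rect_int G x0 x1 y0 y1.
Proof.
move=> cF cG; rewrite /rect_int addrACA -mulrDr; congr (_ + _ * _).
  rewrite -cintD; first by apply: eq_cint => x _; rewrite opprD addrACA.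
  - exact: continuous_onB (continuous_on_bottom y01 cF) (continuous_on_top y01
      cF).
  - exact: continuous_onB (continuous_on_bottom y01 cG) (continuous_on_top y01
      cG).
rewrite -cintD; first by apply: eq_cint => x _; rewrite opprD addrACA.
- exact: continuous_onB (continuous_on_right x01 cF) (continuous_on_left x01
    cF).
- exact: continuous_onB (continuous_on_right x01 cG) (continuous_on_left x01
    cG).
Qed.

Lemma rect_int_bound G M :
  (forall z, frame x0 x1 y0 y1 z -> {for z, continuous G}) ->
  (forall z, frame x0 x1 y0 y1 z -> cabs (G z) <= M) ->
  cabs (rect_int G x0 x1 y0 y1) <= 4 * M * (x1 - x0 + (y1 - y0)).
Proof.
move=> cG GM; apply: le_trans (cabsD _ _) _.
rewrite Normc.normcM cabs_i mul1r.
have -> : 4 * M * (x1 - x0 + (y1 - y0)) =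
  2 * (M + M) * (x1 - x0) + 2 * (M + M) * (y1 - y0) by ring.
apply: lerD; apply: cint_bound => //.
- exact: continuous_onB (continuous_on_bottom y01 cG) (continuous_on_top y01
    cG).
- move=> x xx; apply: le_trans (cabsD _ _) _; rewrite normcN.
  apply: lerD; apply: GM; split; do ?split; rewrite //= ?lexx ?andbT//.
  + by constructor 3.
  + by constructor 4.
- exact: continuous_onB (continuous_on_right x01 cG) (continuous_on_left x01
    cG).
- move=> y yy; apply: le_trans (cabsD _ _) _; rewrite normcN.
  apply: lerD; apply: GM; split; do ?split; rewrite //= ?lexx ?andbT//.
  + by constructor 2.
  + by constructor 1.
Qed.

Lemma rect_int_affine (c A p : R[i]) :
  rect_int (fun z => c + A * (z - p)) x0 x1 y0 y1 = 0.
Proof.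
rewrite /rect_int.
rewrite (_ : (fun x => _) = fun=> A * ('i%C * (y0 - y1)%:C)); last first.
  apply/funext => x; have -> : x +i* y0 = x +i* y1 + 'i%C * (y0 - y1)%:C.
    by ceq.
  ring.
rewrite (_ : (fun y => _ - _) = fun=> A * (x1 - x0)%:C); last first.
  apply/funext => y; have -> : x1 +i* y = x0 +i* y + (x1 - x0)%:C.
    by ceq.
  ring.
rewrite !cint_cst// !rmorphB; ring.
Qed.

Lemma rect_int_split_x G x : x0 <= x -> x <= x1 ->
  (forall z, frame x0 x y0 y1 z -> {for z, continuous G}) ->
  (forall z, frame x x1 y0 y1 z -> {for z, continuous G}) ->
  rect_int G x0 x1 y0 y1 = rect_int G x0 x y0 y1 + rect_int G x x1 y0 y1.
Proof.
move=> x0x xx1 cl cr; rewrite /rect_int addrACA -mulrDr; congr (_ + _ * _).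
  apply: cint_split; first by rewrite x0x.
  by apply: (@continuous_on_cat _ _ x); apply: continuous_onB;
    [exact: continuous_on_bottom cl|exact: continuous_on_top cl|
     exact: continuous_on_bottom cr|exact: continuous_on_top cr].
rewrite -cintD; first by apply: eq_cint => y _; ring.
- exact: continuous_onB (continuous_on_right x0x cl) (continuous_on_left x0x
    cl).
- exact: continuous_onB (continuous_on_right xx1 cr) (continuous_on_left xx1
    cr).
Qed.

Lemma rect_int_split_y G y : y0 <= y -> y <= y1 ->
  (forall z, frame x0 x1 y0 y z -> {for z, continuous G}) ->
  (forall z, frame x0 x1 y y1 z -> {for z, continuous G}) ->
  rect_int G x0 x1 y0 y1 = rect_int G x0 x1 y0 y + rect_int G x0 x1 y y1.
Proof.
move=> y0y yy1 cb ct; rewrite /rect_int addrACA -mulrDr; congr (_ + _ * _).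
  rewrite -cintD; first by apply: eq_cint => x _; ring.
  - exact: continuous_onB (continuous_on_bottom y0y cb) (continuous_on_top y0y
      cb).
  - exact: continuous_onB (continuous_on_bottom yy1 ct) (continuous_on_top yy1
      ct).
apply: cint_split; first by rewrite y0y.
by apply: (@continuous_on_cat _ _ y); apply: continuous_onB;
  [exact: continuous_on_right cb|exact: continuous_on_left cb|
   exact: continuous_on_right ct|exact: continuous_on_left ct].
Qed.

End rect_int_theory.

Lemma derivable_continuous G z : derivable G z 1 -> {for z, continuous G}.
Proof. by move/derivable1_diffP; exact: differentiable_continuous. Qed.

(** Near a point of differentiability the integral of the affine part vanishes
    and the remainder is [o(s)] on a boundary of length [O(s)], whence [o(s^2)]
    in total: this beats the factor 4 lost at each quartering. *)
Lemma rect_int_local G z e : derivable G z 1 -> 0 < e ->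
  exists2 d : R, 0 < d & forall x0 x1 y0 y1,
    x0 <= x1 -> y0 <= y1 -> rect x0 x1 y0 y1 z ->
    (forall z, rect x0 x1 y0 y1 z -> derivable G z 1) ->
    x1 - x0 + (y1 - y0) < d ->
    cabs (rect_int G x0 x1 y0 y1) <= e * (x1 - x0 + (y1 - y0)) ^+ 2.
Proof.
move=> dG e0.
have e40 : 0 < e / 4 by rewrite divr_gt0.
have [d d0 dP] := derivable_has_cderiv dG e40.
exists d => // x0 x1 y0 y1 x01 y01 [zx zy] hG small.
pose L := fun u => G z + 'D_1 G z * (u - z).
pose E := fun u => G u - L u.
have cG u : rect x0 x1 y0 y1 u -> {for u, continuous G}.
  by move/hG; exact: derivable_continuous.
have cL u : {for u, continuous L}.
  apply: continuousD; first exact: cst_continuous.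
  apply: continuousM; first exact: cst_continuous.
  have cI : {for u, continuous (fun v : R[i] => v)} by exact: cvg_id.
  exact: (continuousB cI (@cst_continuous _ _ z u)).
have cE u : rect x0 x1 y0 y1 u -> {for u, continuous E}.
  by move=> /cG cGu; exact: (continuousB cGu (cL u)).
have -> : G = fun u => L u + E u by apply/funext => u; rewrite /E addrC subrK.
have cE' u (uf : frame x0 x1 y0 y1 u) := cE u (frame_rect uf).
rewrite (rect_intD x01 y01 (fun u _ => cL u) cE').
rewrite (rect_int_affine x01 y01) add0r.
set s := _ + _.
have -> : e * s ^+ 2 = 4 * (e / 4 * s) * s by field.
apply: rect_int_bound => // u [[ux uy] _].
have uzs : cabs (u - z) <= s.
  apply: le_trans (cabs_le_ReIm _) _; rewrite !raddfB /s.
  by apply: lerD; rewrite ler_norml; lra.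
have : cabs (u - z) < d by exact: le_lt_trans small.
move=> /dP; rewrite (addrC z) subrK.
have -> : G u - G z - 'D_1 G z * (u - z) = E u by rewrite /E /L opprD addrA.
by move/le_trans; apply; rewrite ler_wpM2l// ltW.
Qed.

(** For every [e] the bound [e s^2], where [s] is half the perimeter, passes
    from the quarters to the whole rectangle, since [4 (s/2)^2 = s^2]. *)
Theorem goursat G x0 x1 y0 y1 : x0 <= x1 -> y0 <= y1 ->
  (forall z, rect x0 x1 y0 y1 z -> derivable G z 1) ->
  rect_int G x0 x1 y0 y1 = 0.
Proof.
move=> x01 y01 hG.
suff le e : 0 < e ->
    cabs (rect_int G x0 x1 y0 y1) <= e * (x1 - x0 + (y1 - y0)) ^+ 2.
  apply: Normc.eq0_normc; apply/le_anti; rewrite cabs_ge0 andbT.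
  set s := (_ + _) ^+ 2 in le.
  have s0 : 0 <= s by exact: sqr_ge0.
  apply/ler_addgt0Pr => e e0; rewrite add0r.
  have /le/le_trans : 0 < e / (s + 1) by rewrite divr_gt0// ltr_wpDl.
  apply; rewrite mulrAC ler_pdivrMr ?ltr_wpDl//.
  by rewrite ler_pM2l ?lerDl.
move=> e0.
pose P x y w h := x0 <= x -> x + w <= x1 -> y0 <= y -> y + h <= y1 ->
  cabs (rect_int G x (x + w) y (y + h)) <= e * (w + h) ^+ 2.
have : P x0 y0 (x1 - x0) (y1 - y0).
  apply: quartering; rewrite ?subr_ge0//.
    move=> x y w h w0 h0 P1 P2 P3 P4 hx hxw hy hyh.
    have sub a b c d : x0 <= a -> b <= x1 -> y0 <= c -> d <= y1 ->
        forall z, frame a b c d z -> {for z, continuous G}.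
      move=> ha hb hc hd z [[/andP[? ?] /andP[? ?]] _].
      by apply: derivable_continuous; apply: hG; split; apply/andP; split; lra.
    have ew : x + w / 2 + w / 2 = x + w by field.
    have eh : y + h / 2 + h / 2 = y + h by field.
    have a1 : x + w / 2 <= x1 by clear P1 P2 P3 P4; lra.
    have a2 : x0 <= x + w / 2 by clear P1 P2 P3 P4; lra.
    have b1 : y + h / 2 <= y1 by clear P1 P2 P3 P4; lra.
    have b2 : y0 <= y + h / 2 by clear P1 P2 P3 P4; lra.
    have xw : x <= x + w / 2 by rewrite lerDl divr_ge0.
    have xw' : x + w / 2 <= x + w by rewrite -ew lerDl divr_ge0.
    have yh : y <= y + h / 2 by rewrite lerDl divr_ge0.
    have yh' : y + h / 2 <= y + h by rewrite -eh lerDl divr_ge0.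
    rewrite (rect_int_split_x (le_trans yh yh') xw xw'); [|exact: sub..].
    rewrite (rect_int_split_y xw yh yh'); [|exact: sub..].
    rewrite (rect_int_split_y xw' yh yh'); [|exact: sub..].
    move: P1 P2 P3 P4; rewrite /P ew eh => P1 P2 P3 P4.
    have -> : e * (w + h) ^+ 2 = (e * (w / 2 + h / 2) ^+ 2 + e * (w / 2 + h /
      2) ^+ 2)
      + (e * (w / 2 + h / 2) ^+ 2 + e * (w / 2 + h / 2) ^+ 2) by field.
    apply: le_trans (cabsD _ _) _; apply: lerD.
      apply: le_trans (cabsD _ _) _; apply: lerD; [exact: (P1 hx a1 hy
        b1)|exact: (P3 hx a1 b2 hyh)].
    apply: le_trans (cabsD _ _) _; apply: lerD; [exact: (P2 a2 hxw hy
      b1)|exact: (P4 a2 hxw b2 hyh)].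
  move=> a b ha hb.
  have hab : derivable G (a +i* b) 1.
    by apply: hG; split => /=; [move: ha|move: hb]; rewrite addrC subrK.
  have [d d0 dP] := rect_int_local hab e0; exists d => // x y w h w0 h0 xa yb
    wh.
  move=> hx hxw hy hyh.
  have ew : x + w - x = w by rewrite addrC addKr.
  have eh : y + h - y = h by rewrite addrC addKr.
  have xw : x <= x + w by rewrite lerDl.
  have yh : y <= y + h by rewrite lerDl.
  have := dP x (x + w) y (y + h) xw yh (conj xa yb); rewrite ew eh; apply.
    move=> z [/andP[? ?] /andP[? ?]].
    by apply: hG; split; apply/andP; split; lra.
  exact: wh.
rewrite /P !(addrC x0) !(addrC y0) !subrK; apply; exact: lexx.
Qed.

End goursat.

(** * The Cauchy estimate *)

Section cauchy_estimate.
Local Open Scope complex_scope.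
Local Notation Re := (@complex.Re _).
Local Notation Im := (@complex.Im _).
Variable R : realType.
Implicit Types (p q r s t : R) (f g G : R[i] -> R[i]).

Definition square_int G p q r := rect_int G (p - r) (p + r) (q - r) (q + r).

(** The region between two concentric squares is cut into four rectangles that
    avoid the centre, and Goursat's theorem applies to each. *)
Lemma square_int_annulus G p q s r : 0 < s -> s <= r ->
  (forall z, rect (p - r) (p + r) (q - r) (q + r) z -> z != p +i* q ->
     derivable G z 1) ->
  square_int G p q r = square_int G p q s.
Proof.
move=> s0 sr hG.
have cG a b c d : p - r <= a -> b <= p + r -> q - r <= c -> d <= q + r ->
    (a < p \/ p < a) -> (b < p \/ p < b) -> (c < q \/ q < c) ->
    (d < q \/ q < d) -> forall z, frame a b c d z -> {for z, continuous G}.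
  move=> pa pb qc qd ha hb hc hd z [[/andP[? ?] /andP[? ?]] zE].
  apply: derivable_continuous; apply: hG; first by split; lra.
  apply/eqP => zpq; move: zE; rewrite zpq /= => -[]; lra.
have G0 a b c d : a <= b -> c <= d ->
    p - r <= a -> b <= p + r -> q - r <= c -> d <= q + r ->
    [\/ b < p, p < a, d < q | q < c] -> rect_int G a b c d = 0.
  move=> ab cd pa pb qc qd far; apply: goursat => // z [/andP[? ?] /andP[? ?]].
  apply: hG; first by split; lra.
  apply/eqP => zpq; subst z; simpl in *; case: far; lra.
have px1 : p - r <= p - s by lra.
have px2 : p - s <= p + r by lra.
have px3 : p - s <= p + s by lra.
have px4 : p + s <= p + r by lra.
have qy1 : q - r <= q - s by lra.
have qy2 : q - s <= q + r by lra.
have qy3 : q - s <= q + s by lra.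
have qy4 : q + s <= q + r by lra.
have qy : q - r <= q + r by lra.
rewrite /square_int (rect_int_split_x qy px1 px2);
  [|by apply: cG; lra|by apply: cG; lra].
rewrite (rect_int_split_x qy px3 px4); [|by apply: cG; lra|by apply: cG; lra].
rewrite (rect_int_split_y px3 qy1 qy2); [|by apply: cG; lra|by apply: cG; lra].
rewrite (rect_int_split_y px3 qy3 qy4); [|by apply: cG; lra|by apply: cG; lra].
have -> : rect_int G (p - r) (p - s) (q - r) (q + r) = 0.
  by apply: G0; first [lra|constructor 1; lra].
have -> : rect_int G (p + s) (p + r) (q - r) (q + r) = 0.
  by apply: G0; first [lra|constructor 2; lra].
have -> : rect_int G (p - s) (p + s) (q - r) (q - s) = 0.
  by apply: G0; first [lra|constructor 3; lra].
have -> : rect_int G (p - s) (p + s) (q + s) (q + r) = 0.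
  by apply: G0; first [lra|constructor 4; lra].
by rewrite !add0r !addr0.
Qed.

Lemma square_frame_far p q s z : 0 < s ->
  frame (p - s) (p + s) (q - s) (q + s) z ->
  s <= cabs (z - (p +i* q)) <= 2 * s.
Proof.
move=> s0 [[/andP[? ?] /andP[? ?]] zE].
have hRe : `|Re z - p| <= s by rewrite ler_norml; lra.
have hIm : `|Im z - q| <= s by rewrite ler_norml; lra.
apply/andP; split; last first.
  by apply: le_trans (cabs_le_ReIm _) _; rewrite !raddfB /= mulr_natl mulr2n
    lerD.
case: zE => zE.
- by apply: le_trans (cabs_Re _); rewrite raddfB /= zE ler_normr; lra.
- by apply: le_trans (cabs_Re _); rewrite raddfB /= zE ler_normr; lra.
- by apply: le_trans (cabs_Im _); rewrite raddfB /= zE ler_normr; lra.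
- by apply: le_trans (cabs_Im _); rewrite raddfB /= zE ler_normr; lra.
Qed.

Lemma sum_sqr_gt0 s t : 0 < s -> 0 < t ^+ 2 + s ^+ 2.
Proof. by move=> s0; rewrite ltr_wpDl ?sqr_ge0// exprn_gt0. Qed.

Lemma inv_diff_horizontal s t : 0 < s ->
  Im ((t +i* (- s))^-1 - (t +i* s)^-1) = 2 * s / (t ^+ 2 + s ^+ 2).
Proof.
move=> s0; have := sum_sqr_gt0 t s0; rewrite raddfB /= => n0.
by rewrite sqrrN; field; rewrite gt_eqF.
Qed.

Lemma inv_diff_vertical s t : 0 < s ->
  Re ((s +i* t)^-1 - ((- s) +i* t)^-1) = 2 * s / (t ^+ 2 + s ^+ 2).
Proof.
move=> s0; have := sum_sqr_gt0 t s0; rewrite raddfB /= => n0.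
by rewrite sqrrN (addrC (s ^+ 2)); field; rewrite gt_eqF.
Qed.

Lemma square_frame_neq p q s z : 0 < s ->
  frame (p - s) (p + s) (q - s) (q + s) z -> z - (p +i* q) != 0.
Proof.
move=> s0 /(square_frame_far s0)/andP[+ _]; apply: contraTneq => ->.
by rewrite Normc.normc0 -ltNge.
Qed.

Lemma derivable_subr (b z : R[i]) : derivable (fun z => z - b) z 1.
Proof. exact: (derivableB (@derivable_id _ _ z 1) (derivable_cst b z 1)). Qed.
#[global] Arguments derivable_subr : clear implicits.

(** The exact value is [2 pi i].  The lower bound comes from the vertical sides
    alone, which contribute the integral of [2 s / (t^2 + s^2) >= 1 / s] on a
    segment of length [2 s]; the contribution of the horizontal sides has the
    same sign. *)
Lemma square_int_inv_ge p q s : 0 < s ->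
  2 <= cabs (square_int (fun z => (z - (p +i* q))^-1) p q s).
Proof.
move=> s0; set K := fun z => _.
have ps : p - s <= p + s by lra.
have qs : q - s <= q + s by lra.
have cK z : frame (p - s) (p + s) (q - s) (q + s) z -> {for z, continuous K}.
  move=> /(square_frame_neq s0) zb; apply: derivable_continuous.
  exact: (derivableV (f := fun w => w - (p +i* q)) zb (derivable_subr _ _)).
apply: le_trans (le_trans (ler_norm _) (cabs_Im _)).
rewrite /square_int /rect_int.
set cx := cint _ _ _; set cy := cint _ _ _.
have -> : Im (cx + 'i%C * cy) = Im cx + Re cy.
  by case: cx cy => [? ?] [? ?] /=; ring.
apply: (@le_trans _ _ (Re cy)).
  apply: (@le_trans _ _ (s^-1 * (q + s - (q - s)))).
    rewrite le_eqVlt; apply/orP; left; apply/eqP; field; exact: lt0r_neq0.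
  apply: cint_Re_ge; [exact: qs| |].
    exact: continuous_onB (continuous_on_right ps cK) (continuous_on_left ps
      cK).
  move=> y yy; rewrite /K.
  have -> : (p + s) +i* y - (p +i* q) = s +i* (y - q) by ceq.
  have -> : (p - s) +i* y - (p +i* q) = (- s) +i* (y - q) by ceq.
  rewrite inv_diff_vertical// ler_pdivlMr ?sum_sqr_gt0// ler_pdivrMl//.
  have sq : (y - q) ^+ 2 <= s ^+ 2.
    rewrite -subr_ge0 subr_sqr mulr_ge0//; lra.
  have -> : s * (2 * s) = s ^+ 2 + s ^+ 2 by ring.
  by rewrite lerD2r.
rewrite lerDr; apply: Rintegral_ge0 => x _; rewrite /K.
have -> : x +i* (q - s) - (p +i* q) = (x - p) +i* (- s) by ceq.
have -> : x +i* (q + s) - (p +i* q) = (x - p) +i* s by ceq.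
by rewrite inv_diff_horizontal// divr_ge0 ?mulr_ge0 ?ltW ?sum_sqr_gt0.
Qed.

(** The Cauchy estimate when the derivative at the centre is 1: on a small
    square [(g z - g b) / (z - b)^2] is close to [1 / (z - b)], whose integral
    is at least 2 in modulus, while on the large square its integral is at most
    [32 B / r]. *)
Lemma cauchy_estimate1 g p q r B : 0 < r ->
  (forall z, rect (p - r) (p + r) (q - r) (q + r) z -> derivable g z 1) ->
  (forall z, rect (p - r) (p + r) (q - r) (q + r) z -> cabs (g z) <= B) ->
  has_cderiv g (p +i* q) 1 -> 1 <= 32 * B / r.
Proof.
move=> r0 hg gB dg; set b := p +i* q.
have [d d0 dP] := dg (1 / 16) ltac:(by rewrite divr_gt0).
pose s := Num.min r (d / 3).
have s0 : 0 < s by rewrite lt_min r0 divr_gt0.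
have sr : s <= r by rewrite ge_min lexx.
have sd : 2 * s < d.
  have : s <= d / 3 by rewrite ge_min lexx orbT.
  by move: d0; clear; lra.
(* [K] is the model singularity, [G] has the same one up to [E]. *)
pose K := fun z : R[i] => (z - b)^-1.
pose G := fun z => (g z - g b) * ((z - b) * (z - b))^-1.
pose E := fun z => K z - G z.
have dG z : rect (p - r) (p + r) (q - r) (q + r) z -> z != b -> derivable G z 1.
  move=> /hg gz zb; have zb0 : (z - b) * (z - b) != 0.
    by rewrite mulf_neq0// subr_eq0.
  exact: (derivableM (derivableB gz (derivable_cst (g b) z 1))
    (derivableV (f := fun w => (w - b) * (w - b)) zb0 (derivableM
      (derivable_subr b z) (derivable_subr b z)))).
have sub z : frame (p - s) (p + s) (q - s) (q + s) z ->
    rect (p - r) (p + r) (q - r) (q + r) z.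
  by move=> [[/andP[? ?] /andP[? ?]] _]; split; apply/andP; split; lra.
have ps t : 0 < t -> p - t <= p + t by lra.
have qs t : 0 < t -> q - t <= q + t by lra.
have cK z : frame (p - s) (p + s) (q - s) (q + s) z -> {for z, continuous K}.
  move=> /(square_frame_neq s0) zb; apply: derivable_continuous.
  exact: (derivableV (f := fun w => w - (p +i* q)) zb (derivable_subr _ _)).
have cG t : 0 < t -> t <= r -> forall z,
    frame (p - t) (p + t) (q - t) (q + t) z -> {for z, continuous G}.
  move=> t0 tr z zf; apply: derivable_continuous; apply: dG.
    by move: zf => [[/andP[? ?] /andP[? ?]] _]; split; apply/andP; split; lra.
  by rewrite -subr_eq0; exact: square_frame_neq zf.
have cE z : frame (p - s) (p + s) (q - s) (q + s) z -> {for z, continuous E}.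
  by move=> zf; exact: (continuousB (cK _ zf) (cG s s0 sr _ zf)).
have bE : cabs (square_int E p q s) <= 1.
  have -> : 1 = 4 * (1 / 16 / s) * (p + s - (p - s) + (q + s - (q - s))) :> R.
    by field; exact: lt0r_neq0.
  apply: rect_int_bound => //; [exact: ps|exact: qs|] => z zf.
  have /andP[zs zs2] := square_frame_far s0 zf.
  have zb := square_frame_neq s0 zf.
  have := dP (z - b) (le_lt_trans zs2 sd); rewrite -/b mul1r.
  have -> : b + (z - b) = z by rewrite addrC subrK.
  have -> : E z = - ((g z - g b - (z - b)) * ((z - b) * (z - b))^-1).
    by rewrite /E /K /G; field.
  rewrite normcN Normc.normcM Normc.normcV Normc.normcM => le1.
  have zb0 := cabs_gt0 zb.
  rewrite ler_pdivrMr ?mulr_gt0//; apply: le_trans le1 _.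
  rewrite mulrA ler_wpM2r ?cabs_ge0// mulrAC ler_pdivlMr//.
  by rewrite ler_pM2l// divr_gt0.
have bG : cabs (square_int G p q r) <= 32 * B / r.
  have -> : 32 * B / r = 4 * ((B + B) / (r * r)) * (p + r - (p - r) + (q + r -
    (q - r))) :> R.
    by field; exact: lt0r_neq0.
  apply: rect_int_bound; [exact: ps|exact: qs|exact: cG|] => z zf.
  have /andP[zr _] := square_frame_far r0 zf.
  have zb0 := cabs_gt0 (square_frame_neq r0 zf).
  rewrite Normc.normcM Normc.normcV Normc.normcM; apply: ler_pM.
  - exact: cabs_ge0.
  - by rewrite invr_ge0 mulr_ge0 ?cabs_ge0.
  - apply: le_trans (cabsD _ _) _; rewrite normcN; apply: lerD; apply: gB.
      exact: frame_rect zf.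
    by rewrite /b; split => /=; apply/andP; split; lra.
  - by rewrite lef_pV2 ?posrE ?mulr_gt0// ler_pM// ltW.
have KE : K = fun z => G z + E z by apply/funext => z; rewrite /E addrC subrK.
have := square_int_inv_ge p q s0; rewrite -/K -/b -/K KE /square_int.
rewrite (rect_intD (ps s s0) (qs s s0) (cG s s0 sr) cE).
rewrite -/(square_int G p q s) -/(square_int E p q s).
rewrite -(square_int_annulus s0 sr dG) => le2.
have := le_trans le2 (cabsD _ _); move: bG bE; clear; lra.
Qed.

Theorem cauchy_estimate f (b : R[i]) r B : 0 < r ->
  (forall z, cabs (z - b) <= r -> derivable f z 1) ->
  (forall z, cabs (z - b) <= r -> cabs (f z) <= B) ->
  cabs ('D_1 f b) <= 64 * B / r.
Proof.
case: b => p q; set b := p +i* q => r0 hf fB.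
have bb : cabs (b - b) <= r by rewrite subrr Normc.normc0 ltW.
have B0 : 0 <= B by exact: le_trans (cabs_ge0 _) (fB b bb).
(* Otherwise [f] is divided by [f'(b)], to make the derivative equal to 1. *)
have [->|A0] := eqVneq ('D_1 f b) 0.
  by rewrite Normc.normc0; apply: divr_ge0 (ltW r0); rewrite mulr_ge0.
set A := 'D_1 f b in A0 *.
have A1 := cabs_gt0 A0.
have r2 : 0 < r / 2 by rewrite divr_gt0.
have sub z : rect (p - r / 2) (p + r / 2) (q - r / 2) (q + r / 2) z ->
    cabs (z - b) <= r.
  move=> [/andP[? ?] /andP[? ?]]; apply: le_trans (cabs_le_ReIm _) _.
  rewrite !raddfB /= (splitr r).
  by apply: lerD; rewrite ler_norml; apply/andP; split; lra.
have := @cauchy_estimate1 (fun z => A^-1 * f z) p q (r / 2) (B / cabs A) r2.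
have -> : 32 * (B / cabs A) / (r / 2) = 64 * B / r / cabs A.
  by field; rewrite !lt0r_neq0.
rewrite ler_pdivlMr// mul1r; apply.
- by move=> z /sub/hf fz; exact: (derivableM (derivable_cst A^-1 z 1) fz).
- move=> z /sub/fB le; rewrite Normc.normcM Normc.normcV mulrC.
  by rewrite ler_pM2r ?invr_gt0.
- move=> e e0; have [|d d0 dP] := derivable_has_cderiv (hf b bb) (e := e * cabs
    A).
    by rewrite mulr_gt0.
  exists d => // h /dP; rewrite -/A => le.
  have -> : A^-1 * f (p +i* q + h) - A^-1 * f (p +i* q) - 1 * h =
      A^-1 * (f (b + h) - f b - A * h) by rewrite /b; field.
  rewrite Normc.normcM Normc.normcV mulrC ler_pdivrMr//.
  by rewrite mulrAC.
Qed.

End cauchy_estimate.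

(** * Weierstrass' theorem and derivatives of holomorphic functions *)

Section weierstrass.
Local Open Scope complex_scope.
Local Notation Re := (@complex.Re _).
Local Notation Im := (@complex.Im _).
Variable R : realType.
Implicit Types (z w c h u A : R[i]) (f g F : R[i] -> R[i]) (r e t B M : R).

Lemma is_derive_eps (phi : R -> R) t (D : R) :
  (forall e, 0 < e -> exists2 d, 0 < d & forall h : R, `|h| < d ->
     `|phi (t + h) - phi t - D * h| <= e * `|h|) ->
  is_derive t 1 phi D.
Proof.
move=> H.
have cv : (fun h : R => h^-1 *: ((phi \o shift t) (h *: 1) - phi t)) @ 0^' -->
  D.
  apply/cvgrPdist_lt => e e0.
  have [|d d0 dP] := H (e / 2); first by rewrite divr_gt0.
  apply/nbhs_ballP; exists d => // h; rewrite -ball_normE /= sub0r normrN.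
  move=> /dP hd h0.
  apply: (@le_lt_trans _ _ (e / 2)); last by move: e0; clear; lra.
  have h0' : 0 < `|h| by rewrite normr_gt0.
  rewrite -(ler_pM2r h0'); apply: le_trans hd.
  rewrite -normrM -normrN.
  suff -> : - ((D - h^-1 *: ((phi \o shift t) (h *: 1) - phi t)) * h) =
    phi (t + h) - phi t - D * h by [].
  rewrite /= [h *: 1]mulr1 [h + t]addrC /GRing.scale/=; field.
  exact: h0.
split; first by apply/cvg_ex; exists D.
exact: (cvg_lim _ cv).
Qed.

(** The chain rule along a straight line; it serves both for the mean value
    inequality and for the two partial derivatives. *)
Lemma is_derive_Re_line f z u t A : has_cderiv f (z + t%:C * u) A ->
  is_derive t 1 (fun s : R => Re (f (z + s%:C * u))) (Re (A * u)).
Proof.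
move=> fA; apply: is_derive_eps => e e0.
have u1 : 0 < cabs u + 1 by rewrite ltr_wpDl// cabs_ge0.
have [|d d0 dP] := fA (e / (cabs u + 1)); first by rewrite divr_gt0.
exists (d / (cabs u + 1)); first by rewrite divr_gt0.
move=> h; rewrite ltr_pdivlMr// => hd.
have uh : cabs (h%:C * u) <= `|h| * (cabs u + 1).
  by rewrite Normc.normcM cabs_real ler_wpM2l// lerDl.
have /dP := le_lt_trans uh hd.
have -> : z + t%:C * u + h%:C * u = z + (t + h)%:C * u.
  by rewrite rmorphD mulrDl addrA.
move=> le; rewrite (_ : _ - _ = Re (f (z + (t + h)%:C * u) -
    f (z + t%:C * u) - A * (h%:C * u))).
  apply: le_trans (cabs_Re _) _; apply: le_trans le _.
  apply: le_trans (ler_wpM2l _ uh) _; first by rewrite divr_ge0 ?ltW.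
  by rewrite mulrCA divfK ?lt0r_neq0// mulrC.
rewrite !raddfB; congr (_ - _).
by case: (A) (u) => [a b] [c d'] /=; ring.
Qed.

Lemma Im_Re_mulNi z : Im z = Re (- 'i%C * z).
Proof. by case: z => a b /=; ring. Qed.

Lemma has_cderivZ f z A c : has_cderiv f z A ->
  has_cderiv (fun w => c * f w) z (c * A).
Proof.
move=> fA e e0; have c1 : 0 < cabs c + 1 by rewrite ltr_wpDl// cabs_ge0.
have [|d d0 dP] := fA (e / (cabs c + 1)); first by rewrite divr_gt0.
exists d => // h /dP le.
rewrite -mulrBr -mulrA -mulrBr Normc.normcM.
apply: le_trans (ler_wpM2l (cabs_ge0 _) le) _.
rewrite mulrA ler_wpM2r ?cabs_ge0// mulrCA ler_piMr ?(ltW e0)//.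
by rewrite ler_pdivrMr// mul1r lerDl.
Qed.

Lemma has_cderivB f g z A (B : R[i]) : has_cderiv f z A -> has_cderiv g z B ->
  has_cderiv (fun w => f w - g w) z (A - B).
Proof.
move=> fA gB e e0; have e2 : 0 < e / 2 by rewrite divr_gt0.
have [d1 d10 dP1] := fA _ e2; have [d2 d20 dP2] := gB _ e2.
exists (Num.min d1 d2); first by rewrite lt_min d10.
move=> h; rewrite lt_min => /andP[/dP1 le1 /dP2 le2].
have -> : f (z + h) - g (z + h) - (f z - g z) - (A - B) * h =
  (f (z + h) - f z - A * h) - (g (z + h) - g z - B * h) by ring.
apply: le_trans (cabsD _ _) _; rewrite normcN.
by move: le1 le2; clear; lra.
Qed.

Lemma has_cderiv_shift f z A h : has_cderiv f (z + h) A ->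
  has_cderiv (fun w => f (w + h)) z A.
Proof.
move=> fA e /fA[d d0 dP]; exists d => // k /dP.
by rewrite [z + k + h]addrAC.
Qed.

Definition ballc c r : set R[i] := [set z | cabs (z - c) < r].

Lemma ballc_center c r : 0 < r -> ballc c r c.
Proof. by move=> r0; rewrite /ballc/= subrr Normc.normc0. Qed.

Lemma ballc_segment c r z w t : ballc c r z -> ballc c r w -> 0 <= t <= 1 ->
  ballc c r (z + t%:C * (w - z)).
Proof.
rewrite /ballc /= => zr wr /andP[t0 t1].
have -> : z + t%:C * (w - z) - c = (1 - t)%:C * (z - c) + t%:C * (w - c).
  by rewrite rmorphB /= ; ring.
apply: le_lt_trans (cabsD _ _) _; rewrite !Normc.normcM !cabs_real.
rewrite (ger0_norm t0) ger0_norm ?subr_ge0//.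
move: t0; rewrite le_eqVlt => /predU1P[<-|t0].
  by rewrite mul0r addr0 subr0 mul1r.
have -> : r = (1 - t) * r + t * r by ring.
by apply: ler_ltD; [rewrite ler_wpM2l ?subr_ge0// ltW|rewrite ltr_pM2l].
Qed.

Lemma mean_value_Re f c r M : (forall z, ballc c r z -> derivable f z 1) ->
  (forall z, ballc c r z -> cabs ('D_1 f z) <= M) ->
  forall z w, ballc c r z -> ballc c r w ->
    `|Re (f w) - Re (f z)| <= M * cabs (w - z).
Proof.
move=> hf fM z w zr wr.
pose phi (s : R) : R := Re (f (z + s%:C * (w - z))).
pose dphi (s : R) : R := Re ('D_1 f (z + s%:C * (w - z)) * (w - z)).
have dP (s : R) : 0 <= s <= 1 -> is_derive s 1 phi (dphi s).
  move=> s01; apply: is_derive_Re_line.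
  by apply: derivable_has_cderiv; apply: hf; exact: ballc_segment.
have [||t] := @MVT_segment _ phi dphi 0 1 ler01.
- by move=> s; rewrite in_itv/= => /andP[? ?]; apply: dP; rewrite !ltW.
- apply: derivable_within_continuous => s; rewrite in_itv/= => s01.
  exact: (@ex_derive _ _ _ _ _ _ _ (dP s s01)).
rewrite in_itv/= subr0 mulr1 => t01 /esym phi01.
have -> : Re (f w) - Re (f z) = dphi t.
  rewrite phi01 /phi mul0r addr0 mul1r.
  by rewrite (addrC z) subrK.
apply: le_trans (cabs_Re _) _; rewrite Normc.normcM ler_wpM2r ?cabs_ge0//.
by apply: fM; exact: ballc_segment.
Qed.

(** The imaginary part is treated as the real part of [- i f]; adding the two
    bounds costs a factor 2. *)
Lemma mean_value f c r M : (forall z, ballc c r z -> derivable f z 1) ->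
  (forall z, ballc c r z -> cabs ('D_1 f z) <= M) ->
  forall z w, ballc c r z -> ballc c r w ->
    cabs (f w - f z) <= 2 * M * cabs (w - z).
Proof.
move=> hf fM z w zr wr; apply: le_trans (cabs_le_ReIm _) _.
rewrite -mulrA mulr_natl mulr2n; apply: lerD.
  by rewrite raddfB; exact: (mean_value_Re hf fM).
have -> : Im (f w - f z) = Re (- 'i%C * f w) - Re (- 'i%C * f z).
  by rewrite Im_Re_mulNi mulrBr raddfB.
apply: (@mean_value_Re (fun v => - 'i%C * f v) c r);
  [| |exact: zr|exact: wr].
  move=> v vr; apply: has_cderiv_derivable.
  exact: has_cderivZ (derivable_has_cderiv (hf _ vr)).
move=> v vr; rewrite (has_cderiv_derive (has_cderivZ _
  (derivable_has_cderiv (hf _ vr)))).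
by rewrite Normc.normcM normcN cabs_i mul1r fM.
Qed.

(** The Cauchy estimate on discs of radius [r / 4] around the points of the
    smaller disc, followed by the mean value inequality there. *)
Lemma lipschitz_of_bound : exists2 C : R, 0 < C & forall f c r B, 0 < r ->
  (forall z, ballc c r z -> derivable f z 1) ->
  (forall z, ballc c r z -> cabs (f z) <= B) ->
  (forall z, ballc c (r / 2) z -> cabs ('D_1 f z) <= C * B / r) /\
  forall z w, ballc c (r / 2) z -> ballc c (r / 2) w ->
    cabs (f w - f z) <= C * B / r * cabs (w - z).
Proof.
have c0 : 0 < 256 :> R by rewrite ltr0n.
exists (2 * 256) => [|f c r B r0 hf fB]; first by rewrite mulr_gt0.
have B0 : 0 <= B.
  by apply: le_trans (cabs_ge0 _) (fB c _); exact: ballc_center.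
have sub z w : ballc c (r / 2) z -> cabs (w - z) <= r / 4 -> ballc c r w.
  rewrite /ballc /= => zr wz.
  have -> : w - c = (w - z) + (z - c) by rewrite addrA subrK.
  by apply: le_lt_trans (cabsD _ _) _; move: r0 zr wz; clear; lra.
have le z : ballc c (r / 2) z -> cabs ('D_1 f z) <= 256 * B / r.
  move=> zr; have -> : 256 * B / r = 64 * B / (r / 4).
    by field; exact: lt0r_neq0.
  apply: cauchy_estimate; first by rewrite divr_gt0.
    by move=> w wz; apply: hf; exact: sub zr wz.
  by move=> w wz; apply: fB; exact: sub zr wz.
have -> : 2 * 256 * B / r = 2 * (256 * B / r) by rewrite !mulrA.
split.
  move=> z /le; move/le_trans; apply.
  have : 0 <= 256 * B / r.
    by apply: divr_ge0 (ltW r0); exact: mulr_ge0 (ltW c0) B0.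
  by clear; set k := _ * _; lra.
move=> z w zr wr.
apply: (@mean_value f c (r / 2)); [|exact: le|exact: zr|exact: wr] => v vr.
apply: hf; apply: sub vr _; rewrite subrr Normc.normc0.
by rewrite divr_ge0// ltW.
Qed.

(** Since [u n - e n <= u m + e m] for all [n] and [m], the supremum of the lower
    bounds [u n - e n] lies within [e n] of each [u n]. *)
Lemma cauchy_limit_real (u e : nat -> R) :
  (forall n m, `|u n - u m| <= e n + e m) ->
  exists a, forall n, `|u n - a| <= e n.
Proof.
move=> H.
have le n m : u n - e n <= u m + e m.
  by have := H n m; rewrite ler_norml => /andP[_]; lra.
have hs : has_sup (range (fun n => u n - e n)).
  split; first by exists (u 0%N - e 0%N), 0%N.
  by exists (u 0%N + e 0%N) => _ [n _ <-].
exists (sup (range (fun n => u n - e n))) => n.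
have : u n - e n <= sup (range (fun n => u n - e n)).
  by apply: sup_upper_bound => //; exists n.
have : sup (range (fun n => u n - e n)) <= u n + e n.
  by apply: ge_sup => [|_ [m _ <-]//]; exact: hs.1.
by rewrite ler_norml; lra.
Qed.

Lemma cauchy_limit (u : nat -> R[i]) (e : nat -> R) :
  (forall n m, cabs (u n - u m) <= e n + e m) ->
  exists A, forall n, cabs (u n - A) <= 2 * e n.
Proof.
move=> H.
have [|a aP] := @cauchy_limit_real (Re \o u) e.
  by move=> n m; apply: le_trans (H n m); rewrite /= -raddfB; exact: cabs_Re.
have [|b bP] := @cauchy_limit_real (Im \o u) e.
  by move=> n m; apply: le_trans (H n m); rewrite /= -raddfB; exact: cabs_Im.
exists (a +i* b) => n; apply: le_trans (cabs_le_ReIm _) _.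
by rewrite !raddfB /= mulr_natl mulr2n; apply: lerD; [exact: aP|exact: bP].
Qed.

(** By the Cauchy estimate, the differences [g n - g m] of approximations of
    [F] have Lipschitz constant [O(e n + e m)] near [c].  Hence the derivatives
      of the
    [g n] at [c] form a Cauchy sequence and, letting [m] grow, the increments
    of [F - g n] from [c] to [c + h] are [O(e n |h|)]. *)
Theorem weierstrass F c r : 0 < r ->
  (forall e, 0 < e -> exists2 g, forall z, ballc c r z -> derivable g z 1 &
     forall z, ballc c r z -> cabs (F z - g z) <= e) ->
  derivable F c 1.
Proof.
move=> r0 H.
pose e n : R := n.+1%:R^-1.
have e0 n : 0 < e n by rewrite invr_gt0.
have eP (x : R) : 0 < x -> exists n, e n < x.
  move=> x0; exists (Num.truncn x^-1).
  by rewrite /e -[ltRHS]invrK ltf_pV2 ?posrE ?invr_gt0 ?truncnS_gt.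
have H' n : exists g : R[i] -> R[i], (forall z, ballc c r z -> derivable g z 1)
  /\
    (forall z, ballc c r z -> cabs (F z - g z) <= e n).
  by have [g ? ?] := H _ (e0 n); exists g.
have {H'}[g gP] := choice H'.
have hg n := (gP n).1; have Fg n := (gP n).2.
have [C C0 lip] := lipschitz_of_bound.
pose L := C / r.
have L0 : 0 < L by rewrite divr_gt0.
have gg n m := lip (fun z => g n z - g m z) c r (e n + e m) r0.
have dgg n m z : ballc c r z ->
    has_cderiv (fun z => g n z - g m z) z ('D_1 (g n) z - 'D_1 (g m) z).
  by move=> zr; apply: has_cderivB; apply: derivable_has_cderiv; exact: hg.
have bgg n m z : ballc c r z -> cabs (g n z - g m z) <= e n + e m.
  move=> zr; have -> : g n z - g m z = (F z - g m z) - (F z - g n z) by ring.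
  apply: le_trans (cabsD _ _) _; rewrite normcN addrC.
  by apply: lerD; exact: Fg.
have {gg} gg n m := gg n m (fun z zr => has_cderiv_derivable (dgg n m z zr))
  (bgg n m).
have c2 : ballc c (r / 2) c by apply: ballc_center; rewrite divr_gt0.
have cr : ballc c r c by exact: ballc_center.
have [|A AP] := @cauchy_limit (fun n => 'D_1 (g n) c) (fun n => L * e n).
  move=> n m; rewrite -(has_cderiv_derive (dgg n m c cr)).
  apply: le_trans ((gg n m).1 c c2) _.
  by rewrite -mulrDr /L mulrAC.
apply: (@has_cderiv_derivable _ _ _ A) => x x0.
have [n en] := eP (x / (8 * L)) ltac:(by rewrite divr_gt0// mulr_gt0).
have [d d0 dP] := derivable_has_cderiv (hg n c cr)
  (ltac:(by rewrite divr_gt0) : 0 < x / 4).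
exists (Num.min d (r / 2)); first by rewrite lt_min d0 divr_gt0.
move=> h; rewrite lt_min => /andP[/dP gh hr].
have chr : ballc c (r / 2) (c + h) by rewrite /ballc/= addrC addKr.
have chr' : ballc c r (c + h).
  by apply: lt_trans chr _; move: r0; clear; lra.
(* Passing from [g n] to [F] in the Lipschitz bound, through [g m] with [m]
   large. *)
have key : cabs (F (c + h) - F c - (g n (c + h) - g n c)) <= L * e n * cabs h.
  apply/ler_addgt0Pr => y y0.
  have k0 : 0 < 2 + L * cabs h by rewrite ltr_wpDr// mulr_ge0 ?cabs_ge0// ltW.
  have [m em] := eP (y / (2 + L * cabs h)) ltac:(by rewrite divr_gt0).
  have -> : F (c + h) - F c - (g n (c + h) - g n c) =
    (F (c + h) - g m (c + h)) - (F c - g m c) -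
    ((g n (c + h) - g m (c + h)) - (g n c - g m c)) by ring.
  apply: le_trans (cabsD _ _) _; rewrite normcN.
  apply: le_trans (lerD (cabsD _ _) ((gg n m).2 _ _ c2 chr)) _; rewrite normcN.
  have -> : c + h - c = h by rewrite addrC addKr.
  have F1 := Fg m _ chr'; have F2 := Fg m _ cr.
  have : e m * (2 + L * cabs h) < y by rewrite -ltr_pdivlMr.
  have -> : C * (e n + e m) / r = L * e n + L * e m.
    by rewrite /L; field; exact: lt0r_neq0.
  have -> : e m * (2 + L * cabs h) = e m + e m + L * e m * cabs h by ring.
  by move: F1 F2; rewrite mulrDl; clear; lra.
have -> : F (c + h) - F c - A * h = (F (c + h) - F c - (g n (c + h) - g n c)) +
  (g n (c + h) - g n c - 'D_1 (g n) c * h) + ('D_1 (g n) c - A) * h by ring.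
apply: le_trans (cabsD _ _) _.
apply: le_trans (lerD (cabsD _ _) (lexx _)) _; rewrite Normc.normcM.
have A1 : cabs ('D_1 (g n) c - A) * cabs h <= 2 * (L * e n) * cabs h.
  by rewrite ler_wpM2r ?cabs_ge0.
have Len : L * e n * cabs h <= x / 8 * cabs h.
  rewrite ler_wpM2r ?cabs_ge0// mulrC -ler_pdivlMr//.
  by apply: le_trans (ltW en) _; rewrite invfM mulrA.
by move: (cabs_ge0 h) x0 A1 Len gh key; rewrite -!mulrA; set k := _ * cabs h;
  nra.
Qed.

(** On a small disc [f'] is Lipschitz, by the Cauchy estimate for
    [f (z + h) - f z], which is itself [O(h)].  Hence the difference quotients
    of [f] converge uniformly to [f'], and they are holomorphic. *)
Theorem holomorphic_derive f c r : 0 < r ->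
  (forall z, ballc c r z -> derivable f z 1) -> derivable ('D_1 f) c 1.
Proof.
move=> r0 hf.
(* Holomorphic functions are locally bounded. *)
have [d d0 dP] : exists2 d, 0 < d & forall z, ballc c d z ->
    derivable f z 1 /\ cabs (f z) <= cabs (f c) + 1.
  have := derivable_continuous (hf _ (ballc_center c r0)).
  move=> /continuous_cabsP/(_ 1 ltr01)[d d0 dP].
  exists (Num.min d r); first by rewrite lt_min d0.
  move=> z; rewrite /ballc/= lt_min => /andP[/dP zd /hf fz]; split=> //.
  rewrite -[f z](subrK (f c)) addrC; apply: le_trans (cabsD _ _) _.
  by rewrite lerD2l ltW.
set B := cabs (f c) + 1 in dP.
have sub s t z : s <= t -> ballc c s z -> ballc c t z.
  by move=> st zs; exact: lt_le_trans st.
have sub2 s t z h : ballc c s z -> cabs h < t -> ballc c (s + t) (z + h).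
  rewrite /ballc/= => zs ht; rewrite addrAC.
  by apply: le_lt_trans (cabsD _ _) _; exact: ltrD.
have [C C0 lip] := lipschitz_of_bound.
have [_ lipf] := lip f c d B d0 (fun z zd => (dP z zd).1)
  (fun z zd => (dP z zd).2).
pose L := C * B / d.
have B0 : 0 < B by rewrite ltr_wpDl// cabs_ge0.
have L0 : 0 < L by rewrite divr_gt0 ?mulr_gt0.
have d4 : 0 < d / 4 by rewrite divr_gt0.
have lipdf h z : cabs h < d / 4 -> ballc c (d / 4 / 2) z ->
    cabs ('D_1 f (z + h) - 'D_1 f z) <= C * (L * cabs h) / (d / 4).
  move=> hd zd.
  have dfh w : ballc c (d / 4) w ->
      has_cderiv (fun w => f (w + h) - f w) w ('D_1 f (w + h) - 'D_1 f w).
    move=> wd; apply: has_cderivB.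
      apply: has_cderiv_shift; apply: derivable_has_cderiv; apply: (dP _ _).1.
      by apply: sub (sub2 _ _ _ _ wd hd); move: d0; clear; lra.
    apply: derivable_has_cderiv; apply: (dP _ _).1.
    by apply: sub wd; move: d0; clear; lra.
  have bfh w : ballc c (d / 4) w -> cabs (f (w + h) - f w) <= L * cabs h.
    move=> wd; have -> : cabs h = cabs (w + h - w) by rewrite addrC addKr.
    apply: lipf; first by apply: sub wd; move: d0; clear; lra.
    by apply: sub (sub2 _ _ _ _ wd hd); move: d0; clear; lra.
  have [+ _] := lip _ _ _ _ d4
    (fun w wd => has_cderiv_derivable (dfh w wd)) bfh.
  move=> /(_ z zd); rewrite (has_cderiv_derive (dfh z _))//.
  by apply: sub zd; move: d0; clear; lra.
pose K := C * L / (d / 4).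
have K0 : 0 < K by rewrite divr_gt0// mulr_gt0.
have d16 : 0 < d / 16 by rewrite divr_gt0.
apply: (weierstrass d16) => e e0.
pose h := Num.min (d / 32) (e / (4 * K)).
have h0 : 0 < h by rewrite lt_min divr_gt0//= divr_gt0// mulr_gt0.
have hd : h < d / 16.
  by apply: (@le_lt_trans _ _ (d / 32)); [rewrite ge_min lexx|move: d0; clear;
    lra].
have hC0 : h%:C != 0 by rewrite -[0]/(0%:C) (inj_eq (@complexI _)) lt0r_neq0.
have hc : cabs h%:C = h by rewrite cabs_real gtr0_norm.
exists (fun z => h%:C^-1 * (f (z + h%:C) - f z)).
  move=> z zd; apply: (@has_cderiv_derivable _ _ _
    (h%:C^-1 * ('D_1 f (z + h%:C) - 'D_1 f z))).
  apply/has_cderivZ/has_cderivB.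
    apply: has_cderiv_shift; apply: derivable_has_cderiv; apply: (dP _ _).1.
    apply: (sub (d / 16 + d / 16)); first by move: d0; clear; lra.
    by apply: sub2 => //; rewrite hc.
  apply: derivable_has_cderiv; apply: (dP _ _).1.
  by apply: sub zd; move: d0; clear; lra.
move=> z zd.
(* [G] has derivative 0 at [z] and [O(h)] on the disc of radius [2 h], which
   contains [z + h]. *)
pose G := fun w => f w - 'D_1 f z * w.
have h2 : 0 < 2 * h by rewrite mulr_gt0.
have h16 : 2 * h <= d / 16.
  have : h <= d / 32 by rewrite ge_min lexx.
  by clear; lra.
have dG w : ballc z (2 * h) w -> has_cderiv G w ('D_1 f w - 'D_1 f z).
  move=> wd; apply: has_cderivB.
    apply: derivable_has_cderiv; apply: (dP _ _).1.
    have -> : w = z + (w - z) by rewrite addrC subrK.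
    by apply: sub (sub2 _ _ _ _ zd wd); move: d0 h16; clear; lra.
  move=> x x0; exists 1 => // k _.
  rewrite (_ : _ - _ = 0); last by ring.
  by rewrite Normc.normc0 mulr_ge0 ?cabs_ge0// ltW.
have G1 : cabs (G (z + h%:C) - G z) <= 2 * (K * (2 * h)) * cabs (z + h%:C - z).
  apply: (@mean_value G z (2 * h)).
  - by move=> w wd; exact: has_cderiv_derivable (dG w wd).
  - move=> w wd; rewrite (has_cderiv_derive (dG w wd)).
    have wd' : cabs (w - z) < 2 * h := wd.
    have -> : 'D_1 f w = 'D_1 f (z + (w - z)) by rewrite (addrC z) subrK.
    apply: le_trans (lipdf _ _ _ _) _.
    - by move: d0 h16 wd'; clear; lra.
    - by apply: sub zd; move: d0; clear; lra.
    - have -> : C * (L * cabs (w - z)) / (d / 4) = K * cabs (w - z).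
        by rewrite /K; field; exact: lt0r_neq0.
      by rewrite ler_pM2l// ltW.
  - exact: ballc_center.
  - rewrite /ballc/= addrC addKr hc.
    by move: h0; clear; lra.
have -> : 'D_1 f z - h%:C^-1 * (f (z + h%:C) - f z) =
    - (h%:C^-1 * (G (z + h%:C) - G z)).
  by rewrite /G; field.
rewrite normcN Normc.normcM Normc.normcV hc mulrC ler_pdivrMr//.
apply: le_trans G1 _; rewrite [z + _]addrC addrK hc ler_pM2r//.
have -> : 2 * (K * (2 * h)) = h * (4 * K) by ring.
have he : h <= e / (4 * K) by rewrite ge_min lexx orbT.
by rewrite -ler_pdivlMr // mulr_gt0.
Qed.

End weierstrass.

(** * Real parts of holomorphic functions are harmonic *)

Section harmonic.
Local Open Scope complex_scope.
Local Notation Re := (@complex.Re _).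
Local Notation Im := (@complex.Im _).
Variable R : realType.
Implicit Types (z w : R[i]) (f : R[i] -> R[i]) (U : R[i] -> R).

Lemma open_discP z : open_disc z <-> cabs z < 1.
Proof. by rewrite /open_disc/= -[`|z|]/((cabs z)%:C) -[1]/(1%:C) ltcR. Qed.

Lemma closed_discP z : closed_disc z <-> cabs z <= 1.
Proof. by rewrite /closed_disc/= -[`|z|]/((cabs z)%:C) -[1]/(1%:C) lecR. Qed.

Lemma open_closed_disc z : open_disc z -> closed_disc z.
Proof. by move=> /open_discP/ltW/closed_discP. Qed.

Lemma ballc_open_disc z w : ballc z (1 - cabs z) w -> open_disc w.
Proof.
rewrite /ballc/= ltrBrDr => wz; apply/open_discP.
by rewrite -[w](subrK z); exact: le_lt_trans (cabsD _ _) wz.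
Qed.

Lemma open_disc_nbhs z : open_disc z -> \forall w \near z, open_disc w.
Proof.
move=> /open_discP z1; apply/nbhs_cabsP; exists (1 - cabs z).
  by rewrite subr_gt0.
by move=> w; exact: ballc_open_disc.
Qed.

Lemma holomorphic_on_derive f : holomorphic_on open_disc f ->
  holomorphic_on open_disc ('D_1 f).
Proof.
move=> hf z /open_discP z1.
apply: (@holomorphic_derive _ _ _ (1 - cabs z)); first by rewrite subr_gt0.
by move=> w /ballc_open_disc; exact: hf.
Qed.

Lemma holomorphic_onZ (c : R[i]) f : holomorphic_on open_disc f ->
  holomorphic_on open_disc (fun z => c * f z).
Proof.
move=> hf z /hf fz; apply: has_cderiv_derivable.
exact: has_cderivZ (derivable_has_cderiv fz).
Qed.

Lemma line_near_open_disc z u : open_disc z ->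
  \forall t \near (0 : R), open_disc (z + t%:C * u).
Proof.
move=> z1; have c : {for 0, continuous (fun t : R => z + t%:C * u)}.
  apply: continuousD; first exact: cst_continuous.
  apply: continuousM; last exact: cst_continuous.
  exact: real_complex_continuous.
apply: c; rewrite mul0r addr0; exact: open_disc_nbhs.
Qed.

Section real_part.
Variables (f : R[i] -> R[i]) (U : R[i] -> R).
Hypotheses (hf : holomorphic_on open_disc f)
  (Uf : forall z, open_disc z -> U z = Re (f z)).

Lemma is_derive_horizontal z : open_disc z ->
  is_derive (0 : R) 1 (horizontal U z) (Re ('D_1 f z)).
Proof.
move=> z1; rewrite -['D_1 f z]mulr1.
apply: (@near_eq_is_derive _ _ _ (fun t : R => Re (f (z + t%:C * 1)))).
  near=> t; rewrite /horizontal mulr1 Uf//.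
  by rewrite -[t%:C]mulr1; near: t; exact: line_near_open_disc.
apply: is_derive_Re_line; rewrite mul0r addr0.
by apply: derivable_has_cderiv; exact: hf.
Unshelve. all: by end_near. Qed.

Lemma is_derive_vertical z : open_disc z ->
  is_derive (0 : R) 1 (vertical U z) (Re ('i%C * 'D_1 f z)).
Proof.
have tiE (t : R) : t*i = t%:C * 'i%C by ceq.
move=> z1; rewrite mulrC.
apply: (@near_eq_is_derive _ _ _ (fun t : R => Re (f (z + t%:C * 'i%C)))).
  near=> t; rewrite /vertical tiE Uf//.
  by near: t; exact: line_near_open_disc.
apply: is_derive_Re_line; rewrite mul0r addr0.
by apply: derivable_has_cderiv; exact: hf.
Unshelve. all: by end_near. Qed.

Lemma partial_x_Re z : open_disc z -> partial_x U z = Re ('D_1 f z).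
Proof.
move=> z1; rewrite /partial_x derive1E.
exact: (@derive_val _ _ _ _ _ _ _ (is_derive_horizontal z1)).
Qed.

Lemma partial_y_Re z : open_disc z -> partial_y U z = Re ('i%C * 'D_1 f z).
Proof.
move=> z1; rewrite /partial_y derive1E.
exact: (@derive_val _ _ _ _ _ _ _ (is_derive_vertical z1)).
Qed.

End real_part.

Lemma continuous_Re_near U f z : open_disc z -> holomorphic_on open_disc f ->
  (forall w, open_disc w -> U w = Re (f w)) -> {for z, continuous U}.
Proof.
move=> z1 hf Uf; suff : U @ z --> Re (f z) by rewrite -Uf.
have : {for z, continuous (fun w => Re (f w))}.
  apply: (@continuous_comp _ _ _ f (@complex.Re R)).
    by apply: derivable_continuous; exact: hf.
  exact: Re_continuous.
apply: cvg_trans; apply: (@near_eq_cvg _ _ (nbhs z) (nbhs_filter z)).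
by apply: (@filterS _ (nbhs z) (nbhs_filter z) _ _ _ (open_disc_nbhs z1)) => w
  /Uf.
Qed.

Lemma C1_on_Re f U : holomorphic_on open_disc f ->
  (forall z, open_disc z -> U z = Re (f z)) -> C1_on open_disc U.
Proof.
move=> hf Uf z z1; split.
- exact: (@ex_derive _ _ _ _ _ _ _ (is_derive_horizontal hf Uf z1)).
- exact: (@ex_derive _ _ _ _ _ _ _ (is_derive_vertical hf Uf z1)).
- exact: (continuous_Re_near z1 (holomorphic_on_derive hf) (partial_x_Re hf
    Uf)).
- exact: (continuous_Re_near z1 (holomorphic_onZ (holomorphic_on_derive hf))
    (partial_y_Re hf Uf)).
Qed.

(** By the Cauchy-Riemann equations the partial derivatives of [Re f] are
    [Re f'] and [Re (i f')], again real parts of holomorphic functions; hence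
    [Re f] is smooth, and its Laplacian is the real part of
    [f'' + i^2 f'' = 0]. *)
Theorem harmonic_Re f U : holomorphic_on open_disc f ->
  (forall z, open_disc z -> U z = Re (f z)) -> harmonic_on open_disc U.
Proof.
move=> hf Uf.
have hx := holomorphic_on_derive hf.
have hy := holomorphic_onZ (c := 'i%C) hx.
have Ux := partial_x_Re hf Uf; have Uy := partial_y_Re hf Uf.
split; first by split;
  [exact: C1_on_Re hf Uf|exact: C1_on_Re hx Ux|exact: C1_on_Re hy Uy].
move=> z z1; rewrite (partial_x_Re hx Ux z1) (partial_y_Re hy Uy z1).
rewrite (has_cderiv_derive (has_cderivZ _ (derivable_has_cderiv (hx z z1)))).
by case: ('D_1 ('D_1 f) z) => a b /=; ring.
Qed.

End harmonic.

(** * The disc algebra and rough boundary values *)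

Section disc_functions.
Local Open Scope complex_scope.
Local Notation Re := (@complex.Re _).
Local Notation Im := (@complex.Im _).
Variable R : realType.
Implicit Types (z w c : R[i]) (F : R[i] -> R[i]) (f g k : disc_algebra R).

Lemma within_disc_continuousP F : {within closed_disc, continuous F} <->
  forall z, cabs z <= 1 -> forall e : R, 0 < e -> exists2 d : R, 0 < d &
    forall w, cabs w <= 1 -> cabs (w - z) < d -> cabs (F w - F z) < e.
Proof.
rewrite subspace_continuousP; split=> H z.
  move=> /closed_discP z1 e e0.
  have /(@cvgrPdist_lt R[i] R[i]) /(_ e%:C) := H z z1.
  rewrite ltcR => /(_ e0); rewrite near_withinE => /nbhs_cabsP[d d0 dP].
  exists d => // w /closed_discP w1 /dP/(_ w1).
  by rewrite -[`|_|]/((cabs _)%:C) ltcR cabsB.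
move=> /closed_discP z1; apply/(@cvgrPdist_lt R[i] R[i]) => e e0.
have eE : e = (Re e)%:C by rewrite RRe_real// gtr0_real.
have [|d d0 dP] := H z z1 (Re e); first by rewrite -ltcR -eE.
rewrite near_withinE; apply/nbhs_cabsP; exists d => // w wd /closed_discP w1.
by rewrite -[`|_|]/((cabs _)%:C) eE ltcR cabsB; exact: dP.
Qed.

(** Elements of the disc algebra vanish outside the closed disc. *)
Definition disc_restrict F z := if cabs z <= 1 then F z else 0.

Lemma disc_restrictE F z : cabs z <= 1 -> disc_restrict F z = F z.
Proof. by rewrite /disc_restrict => ->. Qed.

Lemma disc_restrictP F : {within closed_disc, continuous F} ->
  holomorphic_on open_disc F -> disc_restrict F \in @disc_algebra_pred R.
Proof.
move=> cF hF; apply/disc_algebra_predP; split.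
- apply: subspace_eq_continuous cF => z /set_mem/closed_discP z1.
  exact: esym (disc_restrictE F z1).
- move=> z z1; apply: near_eq_derivable (hF z z1).
  apply: (@filterS _ (nbhs z) (nbhs_filter z) _ _ _ (open_disc_nbhs z1)) => w.
  by move=> /open_closed_disc/closed_discP w1; rewrite disc_restrictE.
- move=> z /closed_discP z1; rewrite /disc_restrict; case: ifPn => //.
Qed.

Lemma disc_algebra_continuous f : {within closed_disc, continuous f}.
Proof. by have /disc_algebra_predP[] := disc_funP f. Qed.

Lemma disc_algebra_holomorphic f : holomorphic_on open_disc f.
Proof. by have /disc_algebra_predP[] := disc_funP f. Qed.

#[global] Arguments disc_algebra_continuous : clear implicits.
#[global] Arguments disc_algebra_holomorphic : clear implicits.

Lemma disc_normP f (M : R) : `|f| <= M%:C <->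
  forall z, cabs z <= 1 -> cabs (f z) <= M.
Proof.
rewrite -[`|f|]/((disc_algebra_norm_real f)%:C) lecR; split=> H.
  move=> z /closed_discP z1; apply: le_trans H; rewrite -lecR.
  exact: disc_algebra_norm_real_ub.
apply: disc_algebra_norm_real_le => z /closed_discP/H.
by rewrite -[`|_|]/((cabs _)%:C) lecR.
Qed.

Lemma disc_uniform_continuity f (e : R) : 0 < e ->
  exists2 d : R, 0 < d & forall z w, cabs z <= 1 -> cabs w <= 1 ->
    cabs (w - z) < d -> cabs (f w - f z) < e.
Proof.
move=> e0.
have /compact_near_coveringP/near_covering_withinP cov := @closed_disc_compact
  R.
have := cov R (0 : R)^'+
  (fun d z => forall w, cabs w <= 1 -> cabs (w - z) < d -> cabs (f w - f z) <
    e).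
move=> /(_ _ _)[]; last first.
  move=> d /= d0 dP; exists (d / 2); first by rewrite divr_gt0.
  move=> z w /closed_discP z1 w1 wz.
  apply: (dP (d / 2) _ _ z z1 w w1 wz); last by rewrite divr_gt0.
  by rewrite /= sub0r normrN gtr0_norm ?divr_gt0//; move: d0; clear; lra.
move=> z /closed_discP z1.
have e2 : 0 < e / 2 by rewrite divr_gt0.
have /within_disc_continuousP/(_ z z1 _ e2)[d d0 dP] := disc_algebra_continuous
  f.
have d2 : 0 < d / 2 by rewrite divr_gt0.
exists ([set w | cabs (w - z) < d / 2], [set x | x < d / 2]) => /=.
  split; first by apply/nbhs_cabsP; exists (d / 2).
  exact: nbhs_right_lt.
move=> [w x] /= [wz xd] /closed_discP w1 v v1 vw.
have vz : cabs (v - z) < d.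
  rewrite -(subrKA w); apply: le_lt_trans (cabsD _ _) _.
  by move: wz xd vw; clear; lra.
have wz' : cabs (w - z) < d by apply: lt_trans wz _; move: d0; clear; lra.
have := dP w w1 wz'; have := dP v v1 vz.
have -> : f v - f w = (f v - f z) - (f w - f z) by ring.
move=> Hv Hw; apply: le_lt_trans (cabsD _ _) _; rewrite normcN.
by move: Hv Hw; clear; lra.
Qed.

Lemma expiD (s t : R) : expi (s + t) = expi s * expi t.
Proof. by rewrite /expi cosD sinD; ceq. Qed.

Lemma cabs_expi (t : R) : cabs (expi t) = 1.
Proof. by rewrite /= cos2Dsin2 sqrtr1. Qed.

Lemma expi0 : expi (0 : R) = 1.
Proof. by rewrite /expi cos0 sin0. Qed.

Lemma expi_pi : expi (pi : R) = -1.
Proof. by rewrite /expi cospi sinpi; apply/eqP; rewrite eq_complex/= oppr0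
  !eqxx. Qed.

Lemma expi_pihalf : expi (pi / 2 : R) = 'i%C.
Proof. by rewrite /expi cos_pihalf sin_pihalf. Qed.

Lemma expi_Npihalf : expi (- (pi / 2) : R) = - 'i%C.
Proof.
rewrite /expi cosN sinN cos_pihalf sin_pihalf.
by apply/eqP; rewrite eq_complex/= oppr0 !eqxx.
Qed.

Lemma expiMn (t : R) n : expi (n%:R * t) = expi t ^+ n.
Proof.
elim: n => [|n IH]; first by rewrite mul0r expi0 expr0.
by rewrite mulrS mulrDl mul1r expiD IH exprS.
Qed.

Lemma expi_periodic (t : R) : expi (t + pi *+ 2) = expi t.
Proof.
(* [pi] is itself defined as a double; abstracting it keeps [mulr2n] away from
   its body. *)
have [p pE] : exists p : R, p = pi by exists pi.
by rewrite -pE mulr2n !expiD pE expi_pi mulrNN !mulr1.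
Qed.

Lemma expi_small (e : R) : 0 < e -> exists2 d : R, 0 < d &
  forall t h : R, `|h| < d -> cabs (expi (t + h) - expi t) < e.
Proof.
move=> e0; have e2 : 0 < e / 2 by rewrite divr_gt0.
have [dc dc0 dcP] : exists2 d, 0 < d & forall h : R, `|h| < d -> `|cos h - 1| <
  e / 2.
  have /cvgrPdist_lt/(_ _ e2)/nbhs_ballP[d d0 dP] := @continuous_cos R 0.
  exists d => // h hd; have := dP h; rewrite -ball_normE/= sub0r normrN => /(_
    hd).
  by rewrite cos0 distrC.
have [ds ds0 dsP] : exists2 d, 0 < d & forall h : R, `|h| < d -> `|sin h| < e /
  2.
  have /cvgrPdist_lt/(_ _ e2)/nbhs_ballP[d d0 dP] := @continuous_sin R 0.
  exists d => // h hd; have := dP h; rewrite -ball_normE/= sub0r normrN => /(_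
    hd).
  by rewrite sin0 sub0r normrN.
exists (Num.min dc ds); first by rewrite lt_min dc0.
move=> t h; rewrite lt_min => /andP[/dcP hc /dsP hs].
rewrite expiD -{2}[expi t]mulr1 -mulrBr Normc.normcM cabs_expi mul1r.
apply: le_lt_trans (cabs_le_ReIm _) _; rewrite /= oppr0 addr0.
by move: hc hs; clear; lra.
Qed.

(** Turning [e^(it)] by [pi / N] negates [w = c e^(iNt)], and turning it by
    [+/- pi / (2N)] multiplies [w] by [+/- i].  As [|Re w| + |Im w| >= 1], one
      of
    the three moves [Re w] by at least one half. *)
Lemma swing c N (t : R) : cabs c = 1 -> (0 < N)%N ->
  exists h : R, [/\ h != 0, `|h| <= pi / N%:R &
    1 / 2 <= `|Re (c * expi (t + h) ^+ N) - Re (c * expi t ^+ N)|].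
Proof.
move=> c1 N0; set w := c * expi t ^+ N.
have N0' : 0 < N%:R :> R by rewrite ltr0n.
have w1 : cabs w = 1.
  rewrite Normc.normcM c1 mul1r; elim: (N) => [|n IH].
    by rewrite expr0 Normc.normc1.
  by rewrite exprS Normc.normcM cabs_expi IH mul1r.
have pi0 := pi_gt0 R.
have turn s : c * expi (t + s / N%:R) ^+ N = w * expi s.
  rewrite expiD exprMn mulrA -/w -expiMn.
  by congr (_ * expi _); rewrite mulrCA divff ?mulr1// lt0r_neq0.
have try_ s : s != 0 -> `|s| <= pi -> 1 / 2 <= `|Re (w * expi s) - Re w| ->
    exists h : R, [/\ h != 0, `|h| <= pi / N%:R &
      1 / 2 <= `|Re (c * expi (t + h) ^+ N) - Re w|].
  move=> s0 sp H; exists (s / N%:R); rewrite turn; split=> //.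
    by rewrite mulf_neq0// invr_neq0// lt0r_neq0.
  by rewrite normrM normfV (gtr0_norm N0') ler_pM2r// invr_gt0.
have := cabs_le_ReIm w; rewrite w1.
have [le1|gt1] := leP (1 / 4) `|Re w|.
  move=> _; apply: (try_ pi); [exact: lt0r_neq0|by rewrite gtr0_norm|].
  rewrite expi_pi mulrN1 raddfN /= -opprD normrN -mulr2n normrMn.
  by rewrite -[_ *+ 2]mulr_natl; move: le1; clear; lra.
move=> le1; have p2 : 0 < pi / 2 :> R by rewrite divr_gt0.
have [i0|i0] := leP 0 (Im w).
  apply: (try_ (- (pi / 2))).
  - by rewrite oppr_eq0 lt0r_neq0.
  - by rewrite normrN gtr0_norm//; move: pi0; clear; lra.
  rewrite expi_Npihalf mulrN raddfN /= ReiNIm opprK.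
  apply: le_trans (ler_norm _).
  move: le1; rewrite (ger0_norm i0).
  by have := ler_norm (Re w); move: gt1; clear; lra.
apply: (try_ (pi / 2)); [exact: lt0r_neq0|
  by rewrite gtr0_norm//; move: pi0; clear; lra|].
rewrite expi_pihalf ReiNIm; apply: le_trans (ler_norm _).
move: le1; rewrite (ltr0_norm i0).
by have := ler_norm (Re w); move: gt1; clear; lra.
Qed.

(** The directions [c = 1] and [c = - i] select the real and the imaginary part
    of [F] on the circle, and allow both to be treated at once.  The strict
    bound with slope [n] at a scale below [1 / (n + 1)] contradicts, for large
    [n], any bound on the difference quotients near [t]. *)
Definition rough c n F := forall t : R, exists h : R,
  [/\ h != 0, `|h| < n.+1%:R^-1 &
      n%:R * `|h| < `|Re (c * F (expi (t + h))) - Re (c * F (expi t))|].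

Lemma derivable_lipschitz_at (u : R -> R) t : derivable u t 1 ->
  exists K, exists2 d, 0 < d &
    forall h, `|h| < d -> `|u (t + h) - u t| <= K * `|h|.
Proof.
move=> ut; have /cvgrPdist_lt/(_ _ ltr01) := ut; set D := lim _.
move=> /nbhs_ballP[d d0 dP]; exists (`|D| + 1), d => // h hd.
have [->|h0] := eqVneq h 0; first by rewrite addr0 subrr normr0 mulr0.
have := dP h; rewrite -ball_normE /= sub0r normrN => /(_ hd h0).
rewrite [h *: 1]mulr1 [h + t]addrC /GRing.scale/= => le1.
have -> : u (t + h) - u t = (h^-1 * (u (t + h) - u t)) * h by field.
rewrite normrM ler_wpM2r//.
rewrite -[h^-1 * _](subrK D); apply: le_trans (ler_normD _ _) _.
by rewrite distrC addrC lerD2l ltW.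
Qed.

Lemma rough_nowhere_differentiable c F : (forall n, rough c n F) ->
  nowhere_differentiable (fun t => Re (c * F (expi t))).
Proof.
move=> rF t /derivable_lipschitz_at[K [d d0 dP]].
pose n := (Num.truncn (Num.max K d^-1)).+1.
have : Num.max K d^-1 < n%:R by rewrite truncnS_gt.
rewrite gt_max => /andP[Kn dn].
have [h [h0 hn hlt]] := rF n t.
have hd : `|h| < d.
  apply: lt_trans hn _; rewrite -[ltRHS]invrK ltf_pV2 ?posrE ?invr_gt0//.
  by apply: lt_trans dn _; rewrite ltr_nat.
have := lt_le_trans hlt (dP h hd); rewrite ltr_pM2r ?normr_gt0//.
by rewrite ltNge ltW.
Qed.

Lemma monomial_algebra (a : R) N :
  disc_restrict (fun z => a%:C * z ^+ N) \in @disc_algebra_pred R.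
Proof.
have der z : derivable (fun z => a%:C * z ^+ N) z 1.
  apply: derivableM; first exact: derivable_cst.
  elim: N => [|N IH].
    by rewrite (_ : (fun _ => _) = cst 1)//; exact: derivable_cst.
  rewrite (_ : (fun _ => _) = (fun z => z) * (fun z => z ^+ N)); last first.
    by apply/funext => w; rewrite exprS.
  exact: (derivableM (@derivable_id _ _ z 1) IH).
apply: disc_restrictP; last by move=> z _; exact: der.
by apply: continuous_subspaceT => z; exact: derivable_continuous.
Qed.

Definition monomial a N : disc_algebra R := DiscAlgebra (monomial_algebra a N).

Lemma monomialE a N z : cabs z <= 1 -> monomial a N z = a%:C * z ^+ N.
Proof. by move=> z1; rewrite /= /disc_restrict z1. Qed.

Lemma cabsB_le z w (a b : R) : cabs z <= a -> cabs w <= b ->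
  cabs (z - w) <= a + b.
Proof.
by move=> za wb; apply: le_trans (cabsD _ _) _; rewrite normcN; exact: lerD.
Qed.

(** The budget: the term [e z^N] moves by [e / 2] along a suitable increment,
    while [f] moves by at most [e / 16], the perturbation [k - g] by at most
    [2 e / 16], and [n |h|] is at most [e / 16]. *)
Lemma rough_perturbation f n (e : R) : 0 < e ->
  exists g, exists2 r : R, 0 < r &
    (forall z, cabs z <= 1 -> cabs (f z - g z) <= e) /\
    forall k, (forall z, cabs z <= 1 -> cabs (k z - g z) <= r) ->
      forall c, cabs c = 1 -> rough c n k.
Proof.
move=> e0.
have e16 : 0 < e / 16 by rewrite divr_gt0.
have [d d0 dP] := disc_uniform_continuity f e16.
have [d' d'0 d'P] := expi_small d0.
have pi0 := pi_gt0 R.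
(* [N] makes [pi / N], which bounds the increment, smaller than [d'], than
   [1 / (n + 1)] and than [e / (16 n)]. *)
pose M := Num.max (d'^-1 * pi) (Num.max (n.+1%:R * pi) (n%:R * pi / (e / 16))).
pose N := (Num.truncn M).+1.
have : M < N%:R by rewrite truncnS_gt.
have N0 : 0 < N%:R :> R by rewrite ltr0n.
rewrite !gt_max => /and3P[N1 N2 N3].
have hN1 : pi / N%:R < d' by rewrite ltr_pdivrMr// -ltr_pdivrMl.
have hN2 : pi / N%:R < n.+1%:R^-1 :> R.
  by rewrite ltr_pdivrMr// -ltr_pdivrMl ?invr_gt0// invrK.
have hN3 : n%:R * (pi / N%:R) < e / 16.
  by rewrite mulrA ltr_pdivrMr// -ltr_pdivrMl// mulrC.
exists (f + monomial e N), (e / 16) => //; split.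
  move=> z z1; rewrite [(f + _) z]/(f z + monomial e N z) monomialE//.
  rewrite opprD addrA subrr sub0r normcN Normc.normcM cabs_real gtr0_norm//.
  rewrite ler_piMr ?(ltW e0)//; elim: (N) => [|m IH].
    by rewrite expr0 Normc.normc1.
  by rewrite exprS Normc.normcM mulr_ile1 ?cabs_ge0.
move=> k kP c c1 t.
have [h [h0 hN hs]] := swing t c1 (isT : (0 < N)%N).
exists h; split=> //; first exact: le_lt_trans hN2.
have ex (s : R) : cabs (expi s) <= 1 by rewrite cabs_expi.
have {}dP := dP _ _ (ex t) (ex (t + h)) (d'P t h (le_lt_trans hN hN1)).
pose E (s : R[i]) : R[i] := k s - (f + monomial e N) s.
have kE (s : R) : k (expi s) = f (expi s) + e%:C * expi s ^+ N + E (expi s).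
  rewrite /E [(f + _) _]/(f _ + monomial e N _) monomialE//.
  by rewrite addrC subrK.
have E1 := kP _ (ex t); have E2 := kP _ (ex (t + h)).
rewrite -raddfB -mulrBr !kE.
have splitE (u v x y p q a : R[i]) : c * (u + a * x + p - (v + a * y + q)) =
    a * (c * x - c * y) + c * ((u - v) + (p - q)) by ring.
rewrite splitE {splitE}.
set A := (_ - c * _); set B := c * (_ + _).
have B1 : cabs B <= e / 16 + (e / 16 + e / 16).
  rewrite Normc.normcM c1 mul1r; apply: le_trans (cabsD _ _) _.
  apply: lerD; first exact: ltW.
  exact: cabsB_le E2 E1.
have A1 : e * (1 / 2) <= `|Re (e%:C * A)|.
  have -> : Re (e%:C * A) = e * Re A by case: (A) => ? ? /=; ring.
  by rewrite normrM gtr0_norm// ler_pM2l// raddfB.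
have nh : n%:R * `|h| <= n%:R * (pi / N%:R) by rewrite ler_wpM2l.
apply: le_lt_trans nh _; apply: lt_trans hN3 _.
have B2 := le_trans (cabs_Re B) B1.
rewrite raddfD /=; have := lerB_normD (Re (e%:C * A)) (Re B).
by move: A1 B2 e0; clear; lra.
Qed.

End disc_functions.

(** * The category argument *)

Section residual_part.
Local Open Scope complex_scope.
Local Notation Re := (@complex.Re _).
Local Notation Im := (@complex.Im _).
Variable R : realType.
Implicit Types (z w c : R[i]) (f g k : disc_algebra R).

Definition disc_ball f (r : R) : set (disc_algebra R) :=
  [set k | forall z, cabs z <= 1 -> cabs (k z - f z) <= r].

Lemma disc_nbhsP f (A : set (disc_algebra R)) : nbhs f A <->
  exists2 r : R, 0 < r & disc_ball f r `<=` A.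
Proof.
split=> [/nbhs_ballP[e e0 eA]|[r r0 rA]].
  have eE : e = (Re e)%:C by rewrite RRe_real// gtr0_real.
  have e0' : 0 < Re e by rewrite -ltcR -eE.
  exists (Re e / 2); first by rewrite divr_gt0.
  move=> k kf; apply: eA; rewrite -ball_normE /= eE.
  apply: (@le_lt_trans _ _ (Re e / 2)%:C); last first.
    by rewrite ltcR; move: e0'; clear; lra.
  by apply/disc_normP => z /kf; rewrite cabsB.
apply/nbhs_ballP; exists r%:C; first by rewrite /= ltcR.
move=> k; rewrite -ball_normE /= => /ltW/disc_normP kf; apply: rA => z /kf.
by rewrite cabsB.
Qed.

(** Completeness, in the form given by nested balls: the balls of radius [r n]
    around [u n] decrease and shrink to a point.  The pointwise limit is
    holomorphic by Weierstrass' theorem. *)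
Lemma disc_uniform_limit (u : nat -> disc_algebra R) (r : nat -> R) :
  (forall x, 0 < x -> exists n, r n < x) ->
  (forall n m, (n <= m)%N -> disc_ball (u n) (r n - r m) (u m)) ->
  (forall n, 0 <= r n) ->
  exists F : disc_algebra R, forall n, disc_ball (u n) (r n) F.
Proof.
move=> r_small unm r0.
have limz z : exists l : R[i], cabs z <= 1 -> forall n, cabs (u n z - l) <= 2 *
  r n.
  have [z1|z1] := leP (cabs z) 1; last by exists 0.
  have [|l lP] := @cauchy_limit R (fun n => u n z) r; last by exists l.
  move=> n m; case/orP: (leq_total n m) => nm.
    rewrite cabsB; apply: le_trans (unm n m nm z z1) _.
    by move: (r0 n) (r0 m); clear; lra.
  apply: le_trans (unm m n nm z z1) _.
  by move: (r0 n) (r0 m); clear; lra.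
have [L LP] := choice limz.
have cL : {within closed_disc, continuous L}.
  apply/within_disc_continuousP => z z1 e e0.
  have [n rn] := r_small (e / 8) ltac:(by rewrite divr_gt0).
  have /within_disc_continuousP/(_ z z1 (e / 4)) := disc_algebra_continuous (u
    n).
  rewrite divr_gt0// => /(_ isT)[d d0 dP]; exists d => // w w1 /(dP w w1) le1.
  have -> : L w - L z = (u n w - u n z) - ((u n w - L w) - (u n z - L z)) by
    ring.
  have := LP w w1 n; have := LP z z1 n => le2 le3.
  apply: le_lt_trans (cabsB_le (lexx _) (cabsB_le le3 le2)) _.
  by move: le1 rn e0; clear; lra.
have hL : holomorphic_on open_disc L.
  move=> z /open_discP z1; apply: (@weierstrass _ L z (1 - cabs z)).
    by rewrite subr_gt0.
  move=> e e0; have [n rn] := r_small (e / 2) ltac:(by rewrite divr_gt0).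
  exists (u n) => w /ballc_open_disc w1.
    exact: disc_algebra_holomorphic.
  rewrite cabsB; have /closed_discP/LP/(_ n) := open_closed_disc w1.
  by move: rn; clear; lra.
exists (DiscAlgebra (disc_restrictP cL hL)) => n z z1.
rewrite [X in X - _]disc_restrictE//.
apply/ler_addgt0Pr => x x0.
have r_anti i j : (i <= j)%N -> r j <= r i.
  move=> ij; have := unm i j ij 0; rewrite Normc.normc0 => /(_ ler01).
  by move/(le_trans (cabs_ge0 _)); rewrite subr_ge0.
(* [cauchy_limit] only gives [2 r n]; comparing with a later term [u m] brings
   the bound down to [r n]. *)
have [m0 rm0] := r_small x x0; pose m := maxn n m0.
have rm : r m < x by apply: le_lt_trans rm0; apply: r_anti; exact: leq_maxr.
have -> : L z - u n z = (u m z - u n z) - (u m z - L z) by ring.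
apply: le_trans (cabsB_le (unm n m (leq_maxl _ _) z z1) (LP z z1 m)) _.
by move: rm; clear; lra.
Qed.

(** Baire's argument: the balls are nested, the one chosen at step [n] lies in
    [O n], and the radii are at least halved at each step, so that
    [disc_uniform_limit] provides the common point. *)
Lemma disc_baire (O : nat -> set (disc_algebra R)) :
  (forall n f e, 0 < e -> exists2 g, disc_ball f e g &
     exists2 r, 0 < r & disc_ball g r `<=` O n) ->
  forall f e, 0 < e -> exists2 F, disc_ball f e F & forall n, O n F.
Proof.
move=> dO f e e0.
have step (q : nat * (disc_algebra R * R)) : exists q' : disc_algebra R * R,
    0 < q.2.2 -> [/\ 0 < q'.2, q'.2 <= q.2.2 / 2,
      disc_ball q.2.1 (q.2.2 - q'.2) q'.1 & disc_ball q'.1 q'.2 `<=` O q.1].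
  case: q => n [g r] /=; have [r0|r0] := ltP 0 r; last by exists (g, r).
  have r2 : 0 < r / 2 by rewrite divr_gt0.
  have [h hg [s s0 hs]] := dO n g _ r2.
  exists (h, Num.min s (r / 2)) => _ /=; split.
  - by rewrite lt_min s0.
  - by rewrite ge_min lexx orbT.
  - move=> z z1; apply: le_trans (hg z z1) _.
    have : Num.min s (r / 2) <= r / 2 by rewrite ge_min lexx orbT.
    by clear; lra.
  - move=> k kh; apply: hs => z z1; apply: le_trans (kh z z1) _.
    by rewrite ge_min lexx.
have [phi phiP] := choice step.
pose fix q n := if n is m.+1 then phi (m, q m) else (f, e).
have r0 n : 0 < (q n).2.
  by elim: n => //= n IH; have [] := phiP (n, q n) IH.
have qS n : [/\ (q n.+1).2 <= (q n).2 / 2,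
    disc_ball (q n).1 ((q n).2 - (q n.+1).2) (q n.+1).1 &
    disc_ball (q n.+1).1 (q n.+1).2 `<=` O n].
  by have [] := phiP (n, q n) (r0 n).
have r_le n : (q n).2 <= e / 2 ^+ n.
  elim: n => [|n IH]; first by rewrite expr0 divr1.
  have [le1 _ _] := qS n; apply: le_trans le1 _.
  rewrite exprS invfM mulrA mulrAC.
  by rewrite ler_pM2r ?invr_gt0.
have [|||F FP] := @disc_uniform_limit (fun n => (q n).1) (fun n => (q n).2).
- move=> x x0; exists (Num.truncn (e / x)).+1.
  have : e / x < (Num.truncn (e / x)).+1%:R by rewrite truncnS_gt.
  set n := _.+1; rewrite ltr_pdivrMr// => lt.
  apply: le_lt_trans (r_le n) _; rewrite ltr_pdivrMr ?exprn_gt0//.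
  apply: lt_le_trans lt _; rewrite mulrC ler_pM2l// -natrX ler_nat.
  exact: (ltnW (ltn_expl _ _)).
- move=> n m; elim: m => [|m IH].
    by rewrite leqn0 => /eqP -> z _; rewrite !subrr Normc.normc0.
  rewrite leq_eqVlt => /predU1P[->|nm] z z1; first by rewrite !subrr
    Normc.normc0.
  have [_ le2 _] := qS m; rewrite -(subrKA ((q m).1 z)).
  apply: le_trans (cabsD _ _) _; rewrite addrC.
  have := IH nm z z1; have := le2 z z1; clear; lra.
- by move=> n; exact: ltW.
exists F; first exact: (FP 0%N).
by move=> n; have [_ _] := qS n; apply; exact: FP.
Qed.

Definition rough_set n : set (disc_algebra R) :=
  [set f | forall c, cabs c = 1 -> rough c n f].

Lemma rough_set_dense n f e : 0 < e -> exists2 g, disc_ball f e g &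
  exists2 r, 0 < r & disc_ball g r `<=` (rough_set n)°.
Proof.
move=> e0; have [g [r r0 [fg gr]]] := rough_perturbation f n e0.
exists g; first by move=> z z1; rewrite cabsB; exact: fg.
have r2 : 0 < r / 2 by rewrite divr_gt0.
exists (r / 2) => // k kg; apply/disc_nbhsP; exists (r / 2) => // h hk c c1.
apply: gr c1 => z z1; rewrite -(subrKA (k z)) (splitr r).
by apply: le_trans (cabsD _ _) _; apply: lerD; [exact: hk|exact: kg].
Qed.

(** [Im f] is a harmonic conjugate of [Re f] that extends continuously to the
    closed disc; its roughness is that of [f] in the direction [- i]. *)
Lemma rough_sets_conjugate f : (forall n, rough_set n f) ->
  nowhere_differentiable_with_conjugate (fun t => Re (f (expi t))).
Proof.
move=> rf; have hf := disc_algebra_holomorphic f.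
have cf := disc_algebra_continuous f.
split.
  have := @rough_nowhere_differentiable _ 1 f.
  under eq_fun do rewrite mul1r; apply => n.
  by apply: rf; exact: Normc.normc1.
exists (fun z => Re (f z)), (fun z => Im (f z)), (fun z => Im (f z)); split.
- split=> [z||//].
    by apply: continuous_comp; [exact: cf|exact: Re_continuous].
  exact: harmonic_Re hf _.
- split.
    apply: (@harmonic_Re _ (fun z => - 'i%C * f z)) => [|z _].
      exact: holomorphic_onZ hf.
    exact: Im_Re_mulNi.
  have fE : (fun z => Re (f z) +i* Im (f z)) = f.
    by apply/funext => w; case: (f w).
  by rewrite fE.
- split=> [z|//].
  by apply: continuous_comp; [exact: cf|exact: Im_continuous].
- have := @rough_nowhere_differentiable _ (- 'i%C) f.
  under eq_fun do rewrite -Im_Re_mulNi; apply => n.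
  by apply: rf; rewrite normcN cabs_i.
Qed.

Lemma disc_algebra_expi_continuous f : continuous (fun t => Re (f (expi t))).
Proof.
move=> t; apply/cvgrPdist_lt => e e0.
have [d d0 dP] := disc_uniform_continuity f e0.
have [d' d'0 d'P] := expi_small d0.
apply/nbhs_ballP; exists d' => // s ts'.
have ts : `|s - t| < d' by rewrite distrC.
rewrite distrC -raddfB; apply: le_lt_trans (cabs_Re _) _.
apply: dP; rewrite ?cabs_expi//.
by have := d'P t (s - t) ts; rewrite (addrC t) subrK.
Qed.

End residual_part.


Theorem theorem2p1 (R : realType) :
  (exists u : R -> R,
     [/\ continuous u, periodic u (pi *+ 2) &
         nowhere_differentiable_with_conjugate u]) /\
  residual [set f : disc_algebra R |
    nowhere_differentiable_with_conjugate (fun t => complex.Re (f (expi t)))].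
Proof.
pose G : set (disc_algebra R) := \bigcap_n (rough_set n)°.
have GP f : G f -> forall n, rough_set n f.
  by move=> Gf n; apply: interior_subset; exact: Gf.
have G_dense f (e : R) : 0 < e -> exists2 F, disc_ball f e F & G F.
  move=> /(disc_baire (@rough_set_dense R) f)[F fF FO].
  by exists F => // n _; exact: FO.
split.
  have [f _ Gf] := G_dense 0 1 ltr01.
  exists (fun t => complex.Re (f (expi t))); split.
  - exact: disc_algebra_expi_continuous.
  - by move=> t; rewrite expi_periodic.
  - exact/rough_sets_conjugate/GP.
exists G; last by move=> f Gf; exact/rough_sets_conjugate/GP.
split.
  by exists (fun n => (rough_set n)°) => // n; exact: open_interior.
move=> O [f Of] oO.
have /disc_nbhsP[r r0 rO] : nbhs f O by apply: open_nbhs_nbhs.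
have [F fF GF] := G_dense f r r0.
by exists F; split; [exact: rO|].
Qed.
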